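(* Let $N\ge 1$ be an integer and let $\lambda_1,\dots,\lambda_m$ be non-negative integers or half-integers with $\lambda_{r+1}-\lambda_r=1$ for all $r$, $\lambda_m\le \frac12 N$, and let $i_\ast\in\{1,\dots,m\}$ be an index with $\lambda_{i_\ast}\le\frac12\sqrt N+1$. Define $L=\lfloor 1.045\,N^{4/7}\rfloor$. Let $n_1,\dots,n_m$ be non-negative integers such that $n_i\ge n_{i+L}$ for all $i\ge i_\ast$ with $i+L\le m$, and let $$S=\frac1N\left(n_1S^{\lambda_1}\oplus\cdots\oplus n_mS^{\lambda_m}\right).$$ Then there are pairwise commuting self-adjoint matrices $A_1',A_2',A_3'$ such that $$\|A_1'-S(\sigma_1)\|,\ \|A_2'-S(\sigma_2)\|\le 6.286\,N^{-1/7},\qquad \|A_3'-S(\sigma_3)\|\le 1.083\,N^{-3/7},$$ and $A_1'$, $iA_2'$, $A_3'$ are real matrices. The same result holds if instead $\lambda_{r+1}-\lambda_r=1/2$ for all $r$.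
   Context: $\|\cdot\|$ is the operator norm. For a non-negative integer or half-integer $\lambda$ (i.e. $2\lambda\in\mathbb Z_{\ge0}$), $S^\lambda$ denotes the irreducible $(2\lambda+1)$-dimensional spin-$\lambda$ representation of $su(2)$, extended complex-linearly to the span of $\sigma_1,\sigma_2,\sigma_3$, given concretely as follows. Let $v_{-\lambda},v_{-\lambda+1},\dots,v_\lambda$ be the standard basis of $\mathbb C^{2\lambda+1}$ and $d_{\lambda,i}=\sqrt{\lambda(\lambda+1)-i(i+1)}$. Then $$S^\lambda(\sigma_3)v_i=i\,v_i,\qquad S^\lambda(\sigma_+)v_i=d_{\lambda,i}\,v_{i+1}\ (i<\lambda),\quad S^\lambda(\sigma_+)v_\lambda=0,\qquad S^\lambda(\sigma_-)=S^\lambda(\sigma_+)^\ast,$$ with $\sigma_+=\sigma_1+i\sigma_2$ and $\sigma_-=\sigma_1-i\sigma_2$, so $S^\lambda(\sigma_1)=\frac12(S^\lambda(\sigma_+)+S^\lambda(\sigma_-))$ and $S^\lambda(\sigma_2)=\frac1{2i}(S^\lambda(\sigma_+)-S^\lambda(\sigma_-))$. The notation $n S^\lambda$ means the direct sum of $n$ copies of $S^\lambda$ ($n$ is a multiplicity), while the prefactor $\frac1N$ is scalar multiplication, so $S(\sigma_j)=\frac1N\bigoplus_r (S^{\lambda_r}(\sigma_j))^{\oplus n_r}$. *)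

(* Defs.v *)
From mathcomp Require Export all_boot all_order all_algebra.
From mathcomp Require Export complex.
From mathcomp Require Export boolp classical_sets reals exp.

Set Implicit Arguments.
Unset Strict Implicit.
Unset Printing Implicit Defensive.

Import Order.TTheory GRing.Theory Num.Theory.
Import complex.
Local Open Scope ring_scope.
Local Open Scope complex_scope.
Local Open Scope sesquilinear_scope.
Local Open Scope classical_set_scope.

Section OperatorNorm.
Context (R : realType).

Definition l2norm n (v : 'cV[R[i]]_n) : R :=
  Num.sqrt (\sum_(i < n) Normc.normc (v i 0) ^+ 2).

(* The ball [l2norm v <= 1] rather than the sphere is used so that the set is
   nonempty (and the norm is 0) also when n = 0. *)
Definition opnorm n (A : 'M[R[i]]_n) : R :=
  sup [set l2norm (A *m v) | v in [set v : 'cV[R[i]]_n | l2norm v <= 1]].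

End OperatorNorm.

Section Spin.
Context (R : realType).

(* A spin lambda is encoded by the natural number k = 2 * lambda, so that the
   representation S^lambda has dimension k.+1. *)
Definition spin (k : nat) : R := k%:R / 2.

(* Basis index j : 'I_k.+1 stands for the vector v_i of weight i = j - lambda;
   matrices act on column vectors. *)
Definition weight (k : nat) (j : nat) : R := j%:R - spin k.

Definition ladder_coef (k : nat) (i : R) : R :=
  Num.sqrt (spin k * (spin k + 1) - i * (i + 1)).

Definition spin_plus (k : nat) : 'M[R[i]]_k.+1 :=
  \matrix_(a, b)
    (if a == b.+1 :> nat then (ladder_coef k (weight k b))%:C else 0).

Definition spin_minus (k : nat) : 'M[R[i]]_k.+1 := (spin_plus k) ^t*.

Definition spin1 (k : nat) : 'M[R[i]]_k.+1 :=
  2^-1 *: (spin_plus k + spin_minus k).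

Definition spin2 (k : nat) : 'M[R[i]]_k.+1 :=
  (2 * 'i%C)^-1 *: (spin_plus k - spin_minus k).

Definition spin3 (k : nat) : 'M[R[i]]_k.+1 :=
  \matrix_(a, b) (if a == b then (weight k b)%:C else 0).

Definition dimS (m : nat) (k n : 'I_m -> nat) : nat :=
  (\sum_(r < m) \sum_(c < n r) (k r).+1)%N.

(* 1/N (n_1 F_1 (+) ... (+) n_m F_m), with n_r copies of F_r = F (k r) *)
Definition scaled_dsum (N m : nat) (k n : 'I_m -> nat)
    (F : forall d : nat, 'M[R[i]]_d.+1) : 'M[R[i]]_(dimS k n) :=
  N%:R^-1 *: mxdiag (fun r : 'I_m => mxdiag (fun c : 'I_(n r) => F (k r))).

Definition Lgap (N : nat) : nat :=
  Num.truncn (1045 / 1000 * (N%:R : R) `^ (4 / 7)).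

End Spin.

(* Main.v *)
Require Import Defs.
From mathcomp Require Import all_boot all_order all_algebra.
From mathcomp Require Import complex.
From mathcomp Require Import boolp classical_sets reals exp.
From mathcomp Require Import ring lra zify.
Set Implicit Arguments.
Unset Strict Implicit.
Unset Printing Implicit Defensive.
Import Order.TTheory GRing.Theory Num.Theory.
Import complex.
Local Open Scope ring_scope.
Local Open Scope complex_scope.

(* Put X = N^(1/7). When X <= 12 the triple (0, 0, S(sigma_3)) already works.

   Otherwise, since n_i >= n_(i + L), the summands split into chains of
   representations whose spins grow by L, with a small bottom spin. Draw the
   weight vectors of a chain in a strip, one row per representation, the weight
   being the abscissa. S(sigma_+) shifts every row to the right, with
   coefficients that vary slowly along a row and from a row to the next one.

   Cut the weights into layers of 2h steps, h ~ X. A path that moves to an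
   adjacent row in each layer bounces between the bottom and the top of the
   strip; one excursion, from bottom to top and back, is a piece, and a piece
   spans at most 2 X^4 weights. The second half of a layer realizes the change
   of row by Berg's gradual exchange: the two basis vectors of equal weight in
   the two rows are rotated into each other in h steps, at the cost of an error
   O(1/h). In the first half of a layer, the rising part and the falling part of
   the same piece lie in the same row, and a second exchange between them cuts
   the piece into closed loops of nearly constant coefficient. Replacing the
   coefficients on a loop by a constant (by 0 if the loop meets the boundary,
   where they are small anyway) makes the operator normal, and it commutes with
   the operator that is constant on each piece. The real and imaginary parts of
   the former and the latter operator are the matrices sought. *)

(** * Operator norm bounds for real matrices, stated with squared norms *)

Section EuclideanBounds.
Variables (R : realFieldType) (d : nat).
Implicit Types (A U : 'M[R]_d) (v : 'cV[R]_d).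

Definition sqnorm v : R := \sum_i v i 0 ^+ 2.

Definition bounded_by (B : R) A := forall v, sqnorm (A *m v) <= B ^+ 2 * sqnorm v.

Lemma sqnorm_ge0 v : 0 <= sqnorm v.
Proof. by apply: sumr_ge0 => i _; apply: sqr_ge0. Qed.

Lemma sqnorm_trmx v : sqnorm v = (v^T *m v) 0 0.
Proof. by rewrite mxE; apply: eq_bigr => i _; rewrite mxE expr2. Qed.

Lemma sqnorm_orth U v : U^T *m U = 1%:M -> sqnorm (U *m v) = sqnorm v.
Proof.
move=> UU; rewrite !sqnorm_trmx trmx_mul -mulmxA (mulmxA U^T) UU.
by rewrite mul1mx.
Qed.

Lemma bounded_orthl B A U : U^T *m U = 1%:M ->
  bounded_by B A -> bounded_by B (U *m A).
Proof. by move=> UU bA v; rewrite -mulmxA sqnorm_orth. Qed.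

Lemma bounded_orthr B A U : U^T *m U = 1%:M ->
  bounded_by B A -> bounded_by B (A *m U).
Proof.
by move=> UU bA v; rewrite -mulmxA (le_trans (bA _)) // sqnorm_orth.
Qed.

(** Coordinatewise [(a + b)^2 <= 2 a^2 + 2 b^2], which loses nothing here because both summands have
    the same bound. *)
Lemma bounded_add B A A' : bounded_by B A -> bounded_by B A' ->
  bounded_by (2 * B) (A + A').
Proof.
move=> bA bA' v; rewrite mulmxDl.
apply: (@le_trans _ _ (2 * sqnorm (A *m v) + 2 * sqnorm (A' *m v))).
  rewrite /sqnorm !mulr_sumr -big_split /=; apply: ler_sum => i _.
  rewrite mxE; set a := (A *m v) i 0; set b := (A' *m v) i 0.
  by have := sqr_ge0 (a - b); nra.
by have := bA v; have := bA' v; rewrite exprMn; lra.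
Qed.

Lemma bounded_scale B a A : bounded_by B A -> bounded_by (a * B) (a *: A).
Proof.
move=> bA v; rewrite -scalemxAl.
have -> : sqnorm (a *: (A *m v)) = a ^+ 2 * sqnorm (A *m v).
  by rewrite /sqnorm mulr_sumr; apply: eq_bigr => i _; rewrite mxE exprMn.
by rewrite exprMn -(mulrA (a ^+ 2) (B ^+ 2)); apply: ler_wpM2l; rewrite ?sqr_ge0 ?bA.
Qed.

Lemma sqr_sum_sparse (I : finType) (F : I -> R) :
  (forall i j, i != j -> F i * F j = 0) ->
  (\sum_i F i) ^+ 2 = \sum_i F i ^+ 2.
Proof.
move=> F0; rewrite expr2 mulr_suml; apply: eq_bigr => i _.
rewrite mulr_sumr (bigD1 i) //= big1 ?addr0 ?expr2 // => j ji.
by rewrite F0 // eq_sym.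
Qed.

(** With at most one nonzero entry per row the cross terms of each squared row sum vanish; after
    exchanging the sums, each [v y 0 ^+ 2] carries at most one squared entry. *)
Lemma bounded_sparse B A :
  (forall x y y', y != y' -> A x y * A x y' = 0) ->
  (forall x x' y, x != x' -> A x y * A x' y = 0) ->
  (forall x y, `|A x y| <= B) -> bounded_by B A.
Proof.
move=> rowA colA leB v; rewrite /sqnorm.
under eq_bigr => x _.
  rewrite mxE sqr_sum_sparse; last first.
    by move=> y y' yy'; rewrite mulrACA rowA ?mul0r.
  over.
rewrite /= exchange_big mulr_sumr /=; apply: ler_sum => y _.
under eq_bigr do rewrite exprMn.
rewrite -mulr_suml; apply: ler_wpM2r; first exact: sqr_ge0.
case: (pickP (fun x => A x y != 0)) => [x0 Ax0|A0]; last first.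
  by rewrite big1 ?sqr_ge0 // => x _; have /negbFE/eqP -> := A0 x; rewrite expr0n.
rewrite (bigD1 x0) //= big1 ?addr0 => [|x xx0].
  by rewrite -real_normK ?num_real // lerXn2r ?nnegrE // (le_trans _ (leB x0 y)).
have /eqP := colA _ _ y xx0; rewrite mulf_eq0 (negPf Ax0) orbF => /eqP ->.
by rewrite expr0n.
Qed.

End EuclideanBounds.

(** * Weighted partial permutations of a labelled basis *)

Section PartialPermutationMatrices.
Variables (R : realFieldType) (V : eqType) (d : nat) (kappa : 'I_d -> V).
Hypothesis kappa_inj : injective kappa.
Implicit Types (f g : V -> R) (p q : V -> V).

Definition present (v : V) := [exists x, kappa x == v].

Lemma present_kappa x : present (kappa x).
Proof. by apply/existsP; exists x. Qed.

Lemma presentP v : reflect (exists x, kappa x = v) (present v).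
Proof.
by apply: (iffP existsP) => [[x /eqP]|[x <-]]; exists x => //; apply/eqP.
Qed.

(* The operator sending the basis vector at v to f v times the one at p v, or to 0
   if no basis vector sits at p v. *)
Definition pmx f p : 'M[R]_d :=
  \matrix_(x, y) (f (kappa y) *+ (p (kappa y) == kappa x)).

Lemma eq_pmx f g p q :
  (forall v, present v -> f v = g v) ->
  (forall v, present v -> f v != 0 -> p v = q v) -> pmx f p = pmx g q.
Proof.
move=> fg pq; apply/matrixP => x y; rewrite !mxE -fg ?present_kappa //.
have [->|fN0] := eqVneq (f (kappa y)) 0; first by rewrite !mul0rn.
by rewrite pq ?present_kappa.
Qed.

Lemma pmx_id1 f : (forall v, present v -> f v = 1) -> pmx f id = 1%:M.
Proof.
move=> f1; apply/matrixP => x y; rewrite !mxE f1 ?present_kappa //.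
by rewrite (inj_eq kappa_inj) eq_sym.
Qed.

(** If [q v] carried no basis vector, the product would kill [v] while the right-hand side might
    not; the premise excludes this. *)
Lemma pmxM f p g q :
  (forall v, present v -> g v != 0 -> present (q v)) ->
  pmx f p *m pmx g q = pmx (fun v => f (q v) * g v) (p \o q).
Proof.
move=> gq; apply/matrixP => x y; rewrite !mxE /=.
have [g0|gN0] := eqVneq (g (kappa y)) 0.
  by rewrite g0 mulr0 mul0rn big1 // => z _; rewrite !mxE g0 mul0rn mulr0.
have /presentP [z qz] := gq _ (present_kappa y) gN0.
rewrite (bigD1 z) //= !mxE -qz eqxx mulr1n big1 => [|t tz].
  by rewrite addr0 mulrnAl.
by rewrite !mxE -qz (inj_eq kappa_inj) (eq_sym z) (negPf tz) mulr0n mulr0.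
Qed.

Lemma pmxD f g p : pmx f p + pmx g p = pmx (fun v => f v + g v) p.
Proof. by apply/matrixP => x y; rewrite !mxE mulrnDl. Qed.

Lemma pmxN f p : - pmx f p = pmx (fun v => - f v) p.
Proof. by apply/matrixP => x y; rewrite !mxE mulNrn. Qed.

Lemma pmxB f g p : pmx f p - pmx g p = pmx (fun v => f v - g v) p.
Proof. by rewrite pmxN pmxD. Qed.

Lemma trmx_pmx f p q :
  (forall v, present v -> q (p v) = v /\ p (q v) = v) ->
  (pmx f p)^T = pmx (f \o q) q.
Proof.
move=> pq; apply/matrixP => x y; rewrite !mxE /=.
have [_ pqy] := pq _ (present_kappa y); have [qpx _] := pq _ (present_kappa x).
have [e|ne] := eqVneq (p (kappa x)) (kappa y).
  by rewrite -e qpx eqxx.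
have [e'|//] := eqVneq (q (kappa y)) (kappa x).
by rewrite -e' pqy eqxx in ne.
Qed.

Lemma trmx_pmx_id f : (pmx f id)^T = pmx f id.
Proof. by rewrite (@trmx_pmx f id id). Qed.

Lemma pmx_bounded B f p :
  (forall v v', present v -> present v' -> p v = p v' -> v = v') ->
  0 <= B -> (forall v, present v -> `|f v| <= B) ->
  bounded_by B (pmx f p) /\ bounded_by B (pmx f p)^T.
Proof.
move=> pI B0 fB.
have row x y y' : y != y' -> pmx f p x y * pmx f p x y' = 0.
  move=> yy'; rewrite !mxE.
  have [e|_] := eqVneq (p (kappa y)) _; last by rewrite mulr0n mul0r.
  have [e'|_] := eqVneq (p (kappa y')) _; last by rewrite mulr0n mulr0.
  case/eqP: yy'; apply: kappa_inj.
  by apply: pI; rewrite ?present_kappa // e e'.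
have col x x' y : x != x' -> pmx f p x y * pmx f p x' y = 0.
  move=> xx'; rewrite !mxE.
  have [e|_] := eqVneq (p (kappa y)) (kappa x); last by rewrite mulr0n mul0r.
  by rewrite e (inj_eq kappa_inj) (negPf xx') mulr0n mulr0.
have leB x y : `|pmx f p x y| <= B.
  by rewrite mxE; case: eqP; rewrite ?mulr1n ?mulr0n ?normr0 ?fB ?present_kappa.
split; first exact: bounded_sparse.
apply: bounded_sparse => [x y y' ne|x x' y ne|x y]; rewrite !mxE.
- by have := col _ _ x ne; rewrite !mxE.
- by have := row y _ _ ne; rewrite !mxE.
- by have := leB y x; rewrite !mxE.
Qed.

End PartialPermutationMatrices.

(** * Plane rotations along an involution *)

Section Rotations.
Variables (R : realFieldType) (V : eqType) (d : nat) (kappa : 'I_d -> V).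
Hypothesis kappa_inj : injective kappa.
Variable tau : V -> V.
Hypothesis tauK : forall v, present kappa v -> tau (tau v) = v.
Local Notation pmx := (@pmx R V d kappa).
Local Notation present := (present kappa).

Definition rotmx (a b : V -> R) : 'M[R]_d := pmx a id + pmx b tau.

(** The sign rule makes the block on [v] and [tau v] a plane rotation. It forces [b v = 0] at a
    fixed point of [tau], and the last clause does so when the partner is missing. *)
Definition rotation (a b : V -> R) := forall v, present v ->
  [/\ a (tau v) = a v, b (tau v) = - b v, a v ^+ 2 + b v ^+ 2 = 1
    & b v != 0 -> present (tau v)].

Lemma rot_tr a b : rotation a b -> (rotmx a b)^T = rotmx a (fun v => - b v).
Proof.
move=> rab; rewrite /rotmx linearD /= trmx_pmx_id; congr (_ + _).
rewrite (@trmx_pmx R V d kappa b tau tau); last by move=> v pv; rewrite !tauK.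
by apply: eq_pmx => // v pv; rewrite /=; case: (rab v pv).
Qed.

Lemma rot_orth a b : rotation a b -> (rotmx a b)^T *m rotmx a b = 1%:M.
Proof.
move=> rab; rewrite rot_tr // /rotmx mulmxDl !mulmxDr.
have pb v : present v -> b v != 0 -> present (tau v) by move=> /rab[].
rewrite !pmxM //.
rewrite addrACA [X in _ + X = _]addrC addrACA.
have -> : pmx (fun v => - b v * a v) (tau \o id) +
          pmx (fun v => a (tau v) * b v) (id \o tau) = 0.
  apply/matrixP => x y; rewrite !mxE /=.
  have [-> _ _ _] := rab _ (present_kappa kappa y).
  by rewrite -mulrnDl mulNr (mulrC (a _)) addNr mul0rn.
rewrite addr0.
have -> : pmx (fun v => - b (tau v) * b v) (tau \o tau) =
          pmx (fun v => b v ^+ 2) id.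
  apply: eq_pmx => v pv /=; last by rewrite tauK.
  by have [_ -> _ _] := rab _ pv; rewrite opprK.
rewrite pmxD; apply: pmx_id1 => // v pv.
by have [_ _ <- _] := rab _ pv; rewrite expr2.
Qed.

Lemma rot_comm_diag a b c : rotation a b ->
  (forall v, present v -> b v != 0 -> c (tau v) = c v) ->
  rotmx a b *m pmx c id = pmx c id *m rotmx a b.
Proof.
move=> rab cb; rewrite /rotmx mulmxDl mulmxDr !pmxM //; last first.
  by move=> v /rab[].
congr (_ + _); apply: eq_pmx => // v pv /=; first by rewrite mulrC.
by have [->|bN0] := eqVneq (b v) 0; rewrite ?mul0r ?mulr0 // cb // mulrC.
Qed.

End Rotations.

(** * Combinatorics of the strip: layers, pieces, exchanges and loops *)

Notation chain v := v.1.1.1.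
Notation piece v := v.1.1.2.
Notation stage v := v.1.2.
Notation tick v := v.2.

Section Conveyor.
Variables (T : eqType) (M n : nat).
Hypotheses (M_gt0 : (0 < M)%N) (n_gt0 : (0 < n)%N).

(* A vector of the strip is (g, b, s, q): chain g, piece b, number s of the layer
   within the piece (rising for s < M, falling for s >= M), step q within the
   layer. Its row, numbered from the top, is row_of s and its abscissa is
   level. *)
Definition cell : Type := (T * int * nat * nat)%type.
Implicit Type v : cell.

Definition valid v := (stage v < 2 * M)%N && (tick v < 2 * n)%N.

Definition row_of (s : nat) : nat := if (s < M)%N then (M.-1 - s)%N else (s - M)%N.

Definition level v : int :=
  (2 * piece v + (stage v)%:Z) * (2 * n)%:Z + (tick v)%:Z.

(** At the end of a layer the row is kept, so the stage becomes the other one of that row,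
    [2M - 1 - s]. The new piece number is then forced: the layer number [2b + s] must grow by
    one. *)
Definition right v : cell :=
  let: (g, b, s, q) := v in
  if (q.+1 < 2 * n)%N then (g, b, s, q.+1)
  else (g, b + s%:Z + 1 - M%:Z, ((2 * M).-1 - s)%N, 0%N).

(* The partner in the exchange: same piece and row for q < n, adjacent row and
   same level for n <= q; the top row and the last layer of a piece exchange
   with nobody in the second half. *)
Definition mate v : cell :=
  let: (g, b, s, q) := v in
  if (q < n)%N then (g, b, ((2 * M).-1 - s)%N, q)
  else if s == (2 * M).-1 then v
  else (g, b + s%:Z + 1 - M%:Z, ((2 * M).-2 - s)%N, q).

Definition is_end v := (tick v == n.-1) || (tick v == (2 * n).-1).

(* The successor along the loops, after both exchanges. *)
Definition next v : cell :=
  let: (g, b, s, q) := v in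
  if q == n.-1 then (g, b, ((2 * M).-1 - s)%N, n)
  else if q == (2 * n).-1 then (g, b, (if s == (2 * M).-1 then 0 else s.+1)%N, 0%N)
  else (g, b, s, q.+1).

Definition prev v : cell :=
  let: (g, b, s, q) := v in
  if q == n then (g, b, ((2 * M).-1 - s)%N, n.-1)
  else if q == 0%N then (g, b, (if s == 0 then (2 * M).-1 else s.-1)%N, (2 * n).-1)
  else (g, b, s, q.-1).

(* The loop containing v, within its piece; label 0 is the cut at the bottom. *)
Definition label v : nat :=
  if (tick v < n)%N then minn (stage v) (2 * M - stage v)
  else minn (stage v).+1 ((2 * M).-1 - stage v).

(** A cell of the loop itself, since [label] is at most [M]; the coefficient of the whole loop is
    read off there. *)
Definition rep v : cell := (chain v, piece v, label v, 0%N).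

Lemma cellE (g g' : T) (b b' : int) (s s' q q' : nat) :
  g = g' -> b = b' -> s = s' -> q = q' -> (g, b, s, q) = (g', b', s', q').
Proof. by move=> -> -> -> ->. Qed.

Lemma valid_rep v : valid v -> valid (rep v).
Proof. case: v => [[[g b] s] q]; rewrite /valid /rep /label /=; case: ifP; lia. Qed.

Lemma valid_mate v : valid v -> valid (mate v).
Proof.
by case: v => [[[g b] s] q]; rewrite /valid /mate /=; repeat case: ifP; rewrite /=; lia.
Qed.

Lemma valid_next v : valid v -> valid (next v).
Proof.
by case: v => [[[g b] s] q]; rewrite /valid /next /=; repeat case: ifP; rewrite /=; lia.
Qed.

Lemma mateK v : valid v -> mate (mate v) = v.
Proof.
case: v => [[[g b] s] q]; rewrite /valid /mate /=; case: ifP => q1 v1.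
  by rewrite q1; apply: cellE => //; lia.
case: ifP => [e|s1]; first by rewrite /mate q1 e.
rewrite /mate q1; case: ifP => [|_]; first lia.
by apply: cellE => //; lia.
Qed.

Lemma nextK v : valid v -> prev (next v) = v.
Proof.
case: v => [[[g b] s] q]; rewrite /valid /next /=; case: ifP => q1 v1.
  by rewrite /prev eqxx; apply: cellE => //; lia.
case: ifP => q2.
  rewrite /prev; case: ifP => [|_]; first lia.
  by rewrite ?eqxx /=; apply: cellE => //; repeat case: ifP => //; lia.
by rewrite /prev; case: ifP => [|_]; first lia.
Qed.

Lemma prevK v : valid v -> next (prev v) = v.
Proof.
case: v => [[[g b] s] q]; rewrite /valid /prev /=; case: ifP => q1 v1.
  by rewrite /next eqxx; apply: cellE => //; lia.
case: ifP => q2.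
  rewrite /next; case: ifP => [|_]; first lia.
  by rewrite eqxx; apply: cellE => //; repeat case: ifP => //; lia.
rewrite /next; case: ifP => [|_]; first lia.
case: ifP => [|_]; first lia.
by apply: cellE => //; lia.
Qed.

(** In the middle of a layer the stage is reflected, at its end it grows by one; the two formulas
    for [label] are shifted against each other so as to absorb both moves. *)
Lemma rep_next v : valid v -> rep (next v) = rep v.
Proof.
case: v => [[[g b] s] q]; rewrite /valid /rep /next /label /= => v1.
case: ifP => q1 /=; first by apply: cellE => //; repeat case: ifP; lia.
case: ifP => q2 /=; first by apply: cellE => //; repeat case: ifP; lia.
by apply: cellE => //; repeat case: ifP; lia.
Qed.

Lemma valid_prev v : valid v -> valid (prev v).
Proof.
by case: v => [[[g b] s] q]; rewrite /valid /prev /=; repeat case: ifP; rewrite /=; lia.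
Qed.

Lemma right_level v : valid v -> level (right v) = level v + 1.
Proof.
case: v => [[[g b] s] q]; rewrite /valid /right /level /= => v1.
case: ifP => q1 /=; first by lia.
have -> : q = (2 * n).-1 by lia.
have -> : (((2 * M).-1 - s)%N : int) = 2 * M%:Z - 1 - s%:Z by lia.
have -> : ((2 * n).-1 : int) = 2 * n%:Z - 1 by lia.
by rewrite PoszM; ring.
Qed.

Lemma right_row v : valid v -> row_of (stage (right v)) = row_of (stage v).
Proof.
case: v => [[[g b] s] q]; rewrite /valid /right /= => v1.
by case: ifP => q1 //=; rewrite /row_of; repeat case: ifP; lia.
Qed.

Lemma right_chain v : chain (right v) = chain v.
Proof. by case: v => [[[g b] s] q]; rewrite /right; case: ifP. Qed.

Lemma valid_right v : valid v -> valid (right v).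
Proof.
by case: v => [[[g b] s] q]; rewrite /valid /right /=; repeat case: ifP; rewrite /=; lia.
Qed.

Lemma right_inj v v' : valid v -> valid v' -> right v = right v' -> v = v'.
Proof.
case: v v' => [[[g b] s] q] [[[g' b'] s'] q']; rewrite /valid /right /= => v1 v2.
by case: ifP => q1; case: ifP => q2 [] *; apply: cellE => //; lia.
Qed.

(** Within a half layer the formula for the partner does not depend on the tick, so partners advance
    together. *)
Lemma right_mate v : valid v -> ~~ is_end v -> mate (right v) = right (mate v).
Proof.
case: v => [[[g b] s] q]; rewrite /valid /is_end /right /mate /= => v1 e1.
have q1 : (q.+1 < 2 * n)%N by lia.
rewrite q1; have -> : (q.+1 < n)%N = (q < n)%N by lia.
by case: ifP => q2; [rewrite q1 | case: ifP => s1; rewrite q1].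
Qed.

Lemma next_right v : valid v -> ~~ is_end v -> next v = right v.
Proof.
case: v => [[[g b] s] q]; rewrite /valid /is_end /right /next /= => v1 e1.
have -> : (q.+1 < 2 * n)%N by lia.
by do 2 (case: ifP => [|_]; first lia).
Qed.

Lemma label_gt0 v : valid v -> (0 < label v)%N ->
  ~~ (tick v == (2 * n).-1) || (stage v != (2 * M).-1).
Proof. by case: v => [[[g b] s] q]; rewrite /valid /label /= => v1; case: ifP; lia. Qed.

(** A completed exchange has turned the vector into its partner, and the loop goes on from there.
    Label 0 is excluded because there [next] wraps from the last stage of the piece to the first. *)
Lemma next_end v : valid v -> (0 < label v)%N -> is_end v ->
  next v = right (mate v).
Proof.
move=> v1 /(label_gt0 v1); case: v v1 => [[[g b] s] q].
rewrite /valid /is_end /right /next /mate /= => v1 l1 e1.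
case: ifP => q1.
  case: ifP => q2; last lia.
  case: ifP => q3; last lia.
  by apply: cellE => //; lia.
have q2 : q == (2 * n).-1 by lia.
have s1 : (s == (2 * M).-1) = false by lia.
have q3 : (q < n)%N = false by lia.
rewrite q2 s1 q3; case: ifP => q4; first lia.
by apply: cellE => //; lia.
Qed.

Lemma chain_mate v : chain (mate v) = chain v.
Proof.
by case: v => [[[g b] s] q]; rewrite /mate; case: ifP => // _; case: ifP.
Qed.

Lemma tick_mate v : tick (mate v) = tick v.
Proof.
by case: v => [[[g b] s] q]; rewrite /mate; case: ifP => // _; case: ifP.
Qed.

Lemma piece_mate v : (tick v < n)%N -> piece (mate v) = piece v.
Proof. by case: v => [[[g b] s] q]; rewrite /mate /= => ->. Qed.

Lemma level_mate v : valid v -> (n <= tick v)%N -> level (mate v) = level v.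
Proof.
case: v => [[[g b] s] q]; rewrite /valid /mate /level /= => v1 q1.
case: ifP => q2; first lia.
case: ifP => s1 //=.
have -> : (((2 * M).-2 - s)%N : int) = 2 * M%:Z - 2 - s%:Z by lia.
by rewrite PoszM; ring.
Qed.

(** A loop runs in at most two adjacent rows, and the partners of its cells stay in these rows. *)
Lemma row_rep v : valid v ->
  ((row_of (stage v) <= (row_of (label v)).+1) &&
   (row_of (label v) <= (row_of (stage v)).+1))%N.
Proof.
by case: v => [[[g b] s] q]; rewrite /valid /label /row_of /= => v1; repeat case: ifP; lia.
Qed.

Lemma row_rep_mate v : valid v ->
  ((row_of (stage (mate v)) <= (row_of (label v)).+1) &&
   (row_of (label v) <= (row_of (stage (mate v))).+1))%N.
Proof.
case: v => [[[g b] s] q]; rewrite /valid /label /mate /= => v1.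
by case: ifP => q1 /=; [|case: ifP => s1 /=]; rewrite /row_of; repeat case: ifP; lia.
Qed.

Lemma level_span (b : int) (s s' q q' : nat) :
  (s < 2 * M)%N -> (s' < 2 * M)%N -> (q < 2 * n)%N -> (q' < 2 * n)%N ->
  (2 * b + s%:Z) * (2 * n)%:Z + q%:Z - ((2 * b + s'%:Z) * (2 * n)%:Z + q'%:Z)
    <= (4 * M * n)%:Z :> int.
Proof.
move=> s1 s2 q1 q2.
have h : (s * (2 * n) + q <= 4 * M * n)%N by nia.
have -> : (2 * b + s%:Z) * (2 * n)%:Z + q%:Z - ((2 * b + s'%:Z) * (2 * n)%:Z + q'%:Z)
   = (s * (2 * n) + q)%N%:Z - (s' * (2 * n) + q')%N%:Z :> int.
  by rewrite !PoszD !PoszM; ring.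
by move: h; move: (_ + q)%N (_ + q')%N (4 * _ * _)%N => *; lia.
Qed.

Lemma level_near v v' : valid v -> valid v' -> piece v = piece v' ->
  `|level v - level v'| <= (4 * M * n)%:Z.
Proof.
move=> /andP[s1 q1] /andP[s2 q2] e; rewrite ler_norml /level e.
rewrite level_span // andbT lerNl opprB.
exact: level_span.
Qed.

(** In the first half of a layer the partner belongs to the same piece; in the second half it may
    leave the piece but keeps the level. *)
Lemma level_rep_mate v : valid v ->
  `|level (mate v) - level (rep v)| <= (4 * M * n)%:Z.
Proof.
move=> v1; have [q1|q1] := ltnP (tick v) n.
  by apply: level_near; rewrite ?piece_mate ?valid_mate ?valid_rep.
by rewrite level_mate //; apply: level_near; rewrite ?valid_rep.
Qed.

Lemma is_end_next v : valid v -> is_end v -> (tick (next v) == 0%N) || (tick (next v) == n).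
Proof.
case: v => [[[g b] s] q]; rewrite /valid /is_end /next /= => v1 e1.
by case: ifP => q1 /=; [lia | case: ifP => q2 /=; lia].
Qed.

Definition phase v : nat := if (tick v < n)%N then tick v else (tick v - n)%N.

(** Orients each exchange, so that partners can be given opposite sines. In the second half of a
    layer the stages of partners add up to [2M - 2], whence the shifted threshold. *)
Definition upward v : bool :=
  if (tick v < n)%N then (stage v < M)%N else ((stage v).+1 < M)%N.

Lemma phase_mate v : phase (mate v) = phase v.
Proof. by rewrite /phase tick_mate. Qed.

Lemma phase_lt v : valid v -> (phase v < n)%N.
Proof. by case: v => [[[g b] s] q]; rewrite /valid /phase /=; case: ifP; lia. Qed.

Lemma phase_end v : valid v -> is_end v -> phase v = n.-1.
Proof.
by case: v => [[[g b] s] q]; rewrite /valid /is_end /phase /=; case: ifP; lia.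
Qed.

Lemma phase_next_end v : valid v -> is_end v -> phase (next v) = 0%N.
Proof.
by move=> v1 e1; move: (is_end_next v1 e1); rewrite /phase; case: ifP; lia.
Qed.

Lemma phase_right v : valid v -> ~~ is_end v -> phase (right v) = (phase v).+1.
Proof.
case: v => [[[g b] s] q]; rewrite /valid /is_end /right /= => v1 e1.
by case: ifP => q1; rewrite /phase /=; repeat case: ifP; lia.
Qed.

Lemma upward_right v : valid v -> ~~ is_end v -> upward (right v) = upward v.
Proof.
case: v => [[[g b] s] q]; rewrite /valid /is_end /right /= => v1 e1.
by case: ifP => q1; rewrite /upward /=; repeat case: ifP; lia.
Qed.

Lemma upward_mate v : valid v -> mate v != v -> upward (mate v) = ~~ upward v.
Proof.
case: v => [[[g b] s] q]; rewrite /valid /upward /mate /= => v1.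
case: ifP => q1 /=; first by rewrite q1; lia.
case: ifP => s1 /=; first by rewrite eqxx.
rewrite q1 => ne.
have sM : s <> M.-1.
  by move=> e; move/eqP: ne; apply; apply: cellE => //; lia.
by lia.
Qed.

Lemma mate_fix_right v : valid v -> ~~ is_end v ->
  (mate (right v) == right v) = (mate v == v).
Proof.
move=> v1 e1; rewrite right_mate //; apply/eqP/eqP => [|-> //].
by move/right_inj; apply; rewrite ?valid_mate.
Qed.

(** * Gradual exchanges and the resulting normal operator *)

Section Exchange.
Variable R : realFieldType.

(* Rational parametrization of the quarter circle from (1, 0) to (0, 1). *)
Definition cosq (t : R) : R := (1 - t ^+ 2) / (1 + t ^+ 2).
Definition sinq (t : R) : R := 2 * t / (1 + t ^+ 2).

Lemma sqr1D_gt0 (t : R) : 0 < 1 + t ^+ 2.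
Proof. by rewrite ltr_wpDr ?sqr_ge0. Qed.

Lemma cosq_sinq t : cosq t ^+ 2 + sinq t ^+ 2 = 1.
Proof.
by have := lt0r_neq0 (sqr1D_gt0 t); rewrite /cosq /sinq => h; field.
Qed.

(** The difference is [2 (t - s)] times [(t + s) / ((1 + s^2)(1 + t^2))], and this quotient is at
    most 1 because [t + s <= 1 + s^2 + t^2]. *)
Lemma cosq_lip s t : 0 <= s <= 1 -> 0 <= t <= 1 -> s <= t ->
  `|cosq s - cosq t| <= 2 * (t - s).
Proof.
move=> s1 t1 st; have := sqr1D_gt0 s; have := sqr1D_gt0 t => ht hs.
have -> : cosq s - cosq t
    = 2 * (t - s) * ((t + s) / ((1 + s ^+ 2) * (1 + t ^+ 2))).
  by rewrite /cosq; field; rewrite !lt0r_neq0.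
have ts0 : 0 <= 2 * (t - s) by lra.
rewrite normrM (ger0_norm ts0) ler_piMr // ger0_norm.
  rewrite ler_pdivrMr ?mulr_gt0 // mul1r.
  have := sqr_ge0 (s - 2^-1); have := sqr_ge0 (t - 2^-1).
  by have := mulr_ge0 (sqr_ge0 s) (sqr_ge0 t); nra.
by apply: divr_ge0; [lra | exact/ltW/mulr_gt0].
Qed.

Lemma sinq_lip s t : 0 <= s <= 1 -> 0 <= t <= 1 -> s <= t ->
  `|sinq s - sinq t| <= 2 * (t - s).
Proof.
move=> s1 t1 st; have := sqr1D_gt0 s; have := sqr1D_gt0 t => ht hs.
have -> : sinq s - sinq t
    = - (2 * (t - s) * ((1 - s * t) / ((1 + s ^+ 2) * (1 + t ^+ 2)))).
  by rewrite /sinq; field; rewrite !lt0r_neq0.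
have st1 : 0 <= s * t <= 1.
  by rewrite mulr_ge0 ?mulr_ile1 //; lra.
have ts0 : 0 <= 2 * (t - s) by lra.
rewrite normrN normrM (ger0_norm ts0) ler_piMr // ger0_norm.
  rewrite ler_pdivrMr ?mulr_gt0 // mul1r.
  have := sqr_ge0 s; have := sqr_ge0 t.
  by have := mulr_ge0 (sqr_ge0 s) (sqr_ge0 t); nra.
by apply: divr_ge0; [lra | exact/ltW/mulr_gt0].
Qed.

Lemma norm_circle_le1 (x y : R) : x ^+ 2 + y ^+ 2 = 1 -> `|x| <= 1.
Proof.
move=> xy; have := sqr_ge0 y => y0.
by rewrite -(@ler_pXn2r _ 2) ?nnegrE // real_normK ?num_real // expr1n -xy lerDl.
Qed.

Lemma cosq_le1 t : `|cosq t| <= 1.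
Proof. exact: norm_circle_le1 (cosq_sinq t). Qed.

Lemma sinq_le1 t : `|sinq t| <= 1.
Proof. by apply: (@norm_circle_le1 _ (cosq t)); rewrite addrC cosq_sinq. Qed.

Lemma cosq0 : cosq 0 = 1. Proof. by rewrite /cosq expr0n /= subr0 addr0 divr1. Qed.
Lemma cosq1 : cosq 1 = 0. Proof. by rewrite /cosq expr1n subrr mul0r. Qed.
Lemma sinq0 : sinq 0 = 0. Proof. by rewrite /sinq mulr0 mul0r. Qed.
Lemma sinq1 : sinq 1 = 1. Proof. by rewrite /sinq expr1n mulr1; field. Qed.

Variables (d : nat) (kappa : 'I_d -> cell).
Hypothesis kappa_inj : injective kappa.
Hypothesis kappa_valid : forall x, valid (kappa x).
Hypothesis kappa_row : forall x, (row_of (stage (kappa x)) < M.-1)%N.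
Local Notation present := (present kappa).
Local Notation pmx := (@pmx R cell d kappa).

Variables (omega : cell -> R) (del C eps : R).
Hypothesis del_ge0 : 0 <= del.
Hypothesis omega_ge0 : forall v, 0 <= omega v.
Hypothesis omega_le : forall v, omega v <= C.
Hypothesis omega_absent : forall v, ~~ present v -> omega v = 0.
Hypothesis omega_near : forall v v', valid v -> valid v' -> chain v = chain v' ->
  (row_of (stage v) <= (row_of (stage v')).+1)%N ->
  (row_of (stage v') <= (row_of (stage v)).+1)%N ->
  `|level v - level v'| <= (4 * M * n)%:Z -> `|omega v - omega v'| <= del.
Hypothesis eps_dead : 2 * del <= eps.
Hypothesis eps_live : del + 2 * C / n%:R <= eps.

Lemma present_valid v : present v -> valid v.
Proof. by case/presentP => x <-. Qed.

(* The common coefficient of the loop through v. If it exceeds del, all vectors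
   of the loop and their partners exist. *)
Definition strength v := omega (rep v).
Definition live v := del < strength v.

Lemma strength_near v : valid v -> `|omega v - strength v| <= del.
Proof.
move=> v1; have /andP[r1 r2] := row_rep v1.
by apply: omega_near => //; [exact: valid_rep | apply: level_near => //; exact: valid_rep].
Qed.

Lemma strength_near_mate v : valid v -> `|omega (mate v) - strength v| <= del.
Proof.
move=> v1; have /andP[r1 r2] := row_rep_mate v1.
apply: omega_near => //; rewrite ?valid_mate ?valid_rep ?chain_mate //.
exact: level_rep_mate.
Qed.

Lemma omega_present v : 0 < omega v -> present v.
Proof. by apply: contraTT => /omega_absent ->; rewrite ltxx. Qed.

Lemma live_present v : valid v -> live v -> present v.
Proof.
move=> v1 lv; apply: omega_present; have := strength_near v1.
by rewrite ler_norml; move: lv; rewrite /live; lra.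
Qed.

Lemma live_present_mate v : valid v -> live v -> present (mate v).
Proof.
move=> v1 lv; apply: omega_present; have := strength_near_mate v1.
by rewrite ler_norml; move: lv; rewrite /live; lra.
Qed.

(** The representative of a loop of label 0 lies in the bottom row, which [kappa_row] keeps empty,
    so its coefficient is 0. *)
Lemma live_label v : live v -> (0 < label v)%N.
Proof.
rewrite lt0n; apply: contraL => /eqP l0; rewrite /live /strength -leNgt.
rewrite omega_absent //; apply/presentP => -[x xv].
by have := kappa_row x; rewrite xv /rep l0 /row_of /= M_gt0 subn0 ltnn.
Qed.

Lemma strength_next v : valid v -> strength (next v) = strength v.
Proof. by move=> v1; rewrite /strength rep_next. Qed.

Lemma live_next v : valid v -> live (next v) = live v.
Proof. by move=> v1; rewrite /live strength_next. Qed.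

(** Symmetric in [v] and [mate v], as a rotation requires; one live loop is enough for both vectors
    to exist. *)
Definition active v := (mate v != v) && (live v || live (mate v)).

Lemma active_mate v : valid v -> active (mate v) = active v.
Proof. by move=> v1; rewrite /active mateK // eq_sym orbC. Qed.

Lemma active_present v : present v -> active v -> present (mate v).
Proof.
move=> pv /andP[_ /orP[]]; have v1 := present_valid pv.
  exact: live_present_mate.
exact/live_present/valid_mate.
Qed.

Definition angle (k : nat) : R := k%:R / n%:R.
Definition sgn v : R := if upward v then 1 else -1.
Definition rcos v := if active v then cosq (angle (phase v)) else 1.
Definition rsin v := if active v then sgn v * sinq (angle (phase v)) else 0.

Lemma angle01 k : (k <= n)%N -> 0 <= angle k <= 1.
Proof.
move=> kn; rewrite divr_ge0 ?ler0n //= ler_pdivrMr ?ltr0n // mul1r ler_nat //.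
Qed.

Lemma angle0 : angle 0 = 0. Proof. by rewrite /angle mul0r. Qed.
Lemma anglen : angle n = 1. Proof. by rewrite /angle divff // pnatr_eq0 -lt0n. Qed.

Lemma angleS k : angle k.+1 - angle k = n%:R^-1.
Proof. by rewrite /angle -mulrBl -natrB // subSnn mul1r. Qed.

Lemma norm_sgn v : `|sgn v| = 1.
Proof. by rewrite /sgn; case: ifP; rewrite ?normrN normr1. Qed.

Lemma sgn_mate v : valid v -> mate v != v -> sgn (mate v) = - sgn v.
Proof.
by move=> v1 ne; rewrite /sgn upward_mate //; case: (upward v); rewrite ?opprK.
Qed.

Lemma rcos_le1 v : `|rcos v| <= 1.
Proof. by rewrite /rcos; case: ifP; rewrite ?normr1 ?cosq_le1. Qed.

Lemma rsin_le1 v : `|rsin v| <= 1.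
Proof.
rewrite /rsin; case: ifP; rewrite ?normr0 // normrM norm_sgn mul1r.
by rewrite sinq_le1.
Qed.

Lemma rotation_on (P : pred cell) : (forall v, P (mate v) = P v) ->
  rotation kappa mate (fun v => if P v then rcos v else 1)
                      (fun v => if P v then rsin v else 0).
Proof.
move=> PM v pv; have v1 := present_valid pv.
rewrite PM /rcos /rsin active_mate // phase_mate.
case: ifP => _; last by rewrite oppr0 expr1n expr0n addr0 eqxx; split.
case: ifP => av; last by rewrite oppr0 expr1n expr0n addr0 eqxx; split.
have ne : mate v != v by case/andP: av.
split => //; first by rewrite sgn_mate // mulNr.
  rewrite (exprMn _ (sgn v)) -[sgn v ^+ 2]real_normK ?num_real // norm_sgn.
  by rewrite expr1n mul1r cosq_sinq.
by move=> _; exact: active_present.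
Qed.

Definition swaps v := (n <= tick v)%N.
Definition loops v := (tick v < n)%N.

Lemma swaps_mate v : swaps (mate v) = swaps v. Proof. by rewrite /swaps tick_mate. Qed.
Lemma loops_mate v : loops (mate v) = loops v. Proof. by rewrite /loops tick_mate. Qed.

Let mateK' v : present v -> mate (mate v) = v.
Proof. by move/present_valid/mateK. Qed.

(* The rotation splits into a factor commuting with the weights (row changes) and
   a factor commuting with functions of the piece (loop closures). Handling them
   separately keeps the error on sigma_3 equal to eta, not 2 eta. *)
Definition Uon (P : pred cell) : 'M[R]_d :=
  rotmx kappa mate (fun v => if P v then rcos v else 1) (fun v => if P v then rsin v else 0).

Definition Uall := rotmx kappa mate rcos rsin.

Lemma Uon_orth P : (forall v, P (mate v) = P v) -> (Uon P)^T *m Uon P = 1%:M.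
Proof. by move=> PM; apply: rot_orth => //; exact: rotation_on. Qed.

(** The factors act on disjoint sets of ticks, so on each basis vector one of them is the
    identity. *)
Lemma Uall_split : Uall = Uon swaps *m Uon loops.
Proof.
have h P (PM : forall v, P (mate v) = P v) v : present v ->
    (if P v then rsin v else 0) != 0 -> present (mate v).
  by move=> pv; have [_ _ _] := rotation_on PM pv.
rewrite /Uall /Uon /rotmx mulmxDl !mulmxDr !pmxM //; try exact: h loops_mate.
have sl v : swaps v = ~~ loops v by rewrite /swaps /loops leqNgt.
rewrite [X in _ = _ + (_ + X)](_ : _ = 0) ?addr0 -?addrA.
  congr (_ + _).
    by apply: eq_pmx => // v pv /=; rewrite sl; case: loops; rewrite /= ?mul1r ?mulr1.
  apply/matrixP => x y; rewrite !mxE /= -mulrnDl !sl loops_mate.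
  by case: (loops _); rewrite /= ?mul0r ?mul1r ?mulr1 ?mulr0 ?add0r ?addr0.
apply/matrixP => x y; rewrite !mxE !sl loops_mate.
by case: (loops _); rewrite /= ?mul0r ?mulr0 mul0rn.
Qed.

(** The sign is what a completed exchange leaves behind: its cosine has reached 0 and its sine
    [sgn v]. *)
Definition nextw v : R :=
  if live v then strength v * (if is_end v && (mate v != v) then sgn v else 1) else 0.

Definition Tmx := pmx nextw next.

Lemma nextw_sqr v : nextw v ^+ 2 = if live v then strength v ^+ 2 else 0.
Proof.
rewrite /nextw; case: ifP => _; last by rewrite expr0n.
rewrite exprMn -[X in _ * X]real_normK ?num_real //.
by case: ifP => _; rewrite ?norm_sgn ?normr1 expr1n mulr1.
Qed.

Lemma nextw_present v : present v -> nextw v != 0 -> present (next v).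
Proof.
move=> /present_valid v1; rewrite /nextw; case: ifP => [lv _|_]; last by rewrite eqxx.
by apply: live_present; [exact: valid_next | rewrite live_next].
Qed.

(** [next] permutes each live loop and the coefficients have constant modulus along it, so both
    products are the same diagonal matrix of squared strengths. *)
Lemma Tmx_normal : Tmx *m Tmx^T = Tmx^T *m Tmx.
Proof.
have trT : Tmx^T = pmx (nextw \o prev) prev.
  apply: trmx_pmx => v /present_valid v1.
  by rewrite nextK ?prevK.
rewrite trT !pmxM //; [|exact: nextw_present|]; last first.
  move=> v /present_valid v1 /=; rewrite /nextw; case: ifP => [lv _|_].
    by apply: live_present => //; exact: valid_prev.
  by rewrite eqxx.
apply: eq_pmx => v /present_valid v1 /=; last by rewrite nextK ?prevK.
rewrite nextK // -!expr2 !nextw_sqr.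
have v2 := valid_prev v1.
by rewrite -(live_next v2) -(strength_next v2) prevK.
Qed.

Definition newcos v : R :=
  if live v then strength v * (if mate v == v then 1 else cosq (angle (phase v).+1)) else 0.
Definition newsin v : R :=
  if live v && (mate v != v) then strength v * (sgn v * sinq (angle (phase v).+1)) else 0.

Lemma rcos_next_end v : valid v -> is_end v -> rcos (next v) = 1.
Proof.
by move=> v1 ev; rewrite /rcos phase_next_end // angle0 cosq0 if_same.
Qed.

Lemma rsin_next_end v : valid v -> is_end v -> rsin (next v) = 0.
Proof.
by move=> v1 ev; rewrite /rsin phase_next_end // angle0 sinq0 mulr0 if_same.
Qed.

Lemma active_live v : live v -> active v = (mate v != v).
Proof. by move=> lv; rewrite /active lv andbT. Qed.

(** [Tmx] moves the vector before it is rotated, hence the angle of the following phase. At an end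
    the rotation on arrival is trivial, and the sign in [nextw] agrees with the formula because
    [cosq 1 = 0] and [sinq 1 = 1]. *)
Lemma UT_split : Uall *m Tmx = pmx newcos right + pmx newsin (right \o mate).
Proof.
rewrite /Uall /rotmx mulmxDl !pmxM //; try exact: nextw_present.
apply/matrixP => x y; rewrite !mxE /=; set v := kappa y.
have v1 : valid v by exact: kappa_valid.
rewrite /newcos /newsin /nextw; case: ifP => lv /=; last by rewrite !mulr0 !mul0rn.
have lnv : live (next v) by rewrite live_next.
have [ev|ev] := boolP (is_end v); rewrite /=.
  rewrite rcos_next_end // rsin_next_end // mul0r mul0rn addr0 mul1r.
  rewrite next_end ?live_label // phase_end // prednK // anglen cosq1 sinq1.
  by case: eqP => [->|_] /=; rewrite ?mulr0 ?mul0rn ?mulr1 ?addr0 ?add0r.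
have nr := next_right v1 ev; rewrite nr in lnv *.
rewrite /rcos /rsin active_live // mate_fix_right // phase_right //.
rewrite right_mate // /sgn upward_right // mulr1.
by case: eqP => [->|_] /=; rewrite ?mul1r ?mulr1 ?mul0r // mulrC [X in _ + X *+ _]mulrC.
Qed.

Lemma SU_split : pmx omega right *m Uall =
  pmx (fun v => omega v * rcos v) right +
  pmx (fun v => omega (mate v) * rsin v) (right \o mate).
Proof.
rewrite /Uall /rotmx mulmxDr !pmxM // => v pv; rewrite /rsin.
by case: ifP => [av _|_]; rewrite ?eqxx //; exact: active_present.
Qed.

Lemma strength_le v : `|strength v| <= C.
Proof. by rewrite ger0_norm; [exact: omega_le | exact: omega_ge0]. Qed.

Lemma strength_dead v : ~~ live v -> strength v <= del.
Proof. by rewrite /live -leNgt. Qed.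

(** The two errors on a live loop: the variation of the coefficient, at most [del], and one step of
    the angle, at most [2 C / n]. *)
Lemma scaled_diff (a c x y : R) : `|a - c| <= del -> `|c| <= C -> `|x| <= 1 ->
  `|x - y| <= 2 / n%:R -> `|c * y - a * x| <= eps.
Proof.
move=> ac cC x1 xy; apply: le_trans eps_live.
have -> : c * y - a * x = - ((a - c) * x) - c * (x - y) by ring.
rewrite (le_trans (ler_normB _ _)) // normrN !normrM lerD //.
  by rewrite -[leRHS]mulr1 ler_pM.
by rewrite [2 * C]mulrC -mulrA ler_pM.
Qed.

(** On a dead loop the sampled coefficient [c] is at most [del], so the true coefficient [a],
    replaced by 0, is at most [2 * del]. *)
Lemma dead_le a c x : `|a - c| <= del -> 0 <= c -> c <= del -> `|x| <= 1 ->
  `|0 - a * x| <= eps.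
Proof.
move=> ac c0 cd x1; apply: le_trans eps_dead; rewrite sub0r normrN normrM.
rewrite -[leRHS]mulr1 ler_pM //.
by move: ac; rewrite !ler_norml; lra.
Qed.

Lemma newcos_near v : valid v -> `|newcos v - omega v * rcos v| <= eps.
Proof.
move=> v1; rewrite /newcos; case: ifPn => lv; last first.
  by apply: dead_le (strength_near v1) _ (strength_dead lv) (rcos_le1 v); exact: omega_ge0.
rewrite /rcos active_live //; case: eqP => _ /=.
  apply: scaled_diff (strength_near v1) (strength_le v) _ _; rewrite ?normr1 //.
  by rewrite subrr normr0 divr_ge0.
apply: scaled_diff (strength_near v1) (strength_le v) (cosq_le1 _) _.
have pn := phase_lt v1.
rewrite (le_trans (cosq_lip _ _ _)) ?angle01 ?(ltnW pn) ?angleS //.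
by rewrite -subr_ge0 angleS invr_ge0.
Qed.

Lemma newsin_near v : valid v -> `|newsin v - omega (mate v) * rsin v| <= eps.
Proof.
move=> v1; rewrite /newsin; have [lv|lv] /= := boolP (live v); last first.
  by apply: dead_le (strength_near_mate v1) _ (strength_dead lv) (rsin_le1 v);
    exact: omega_ge0.
rewrite /rsin active_live //; case: eqP => _ /=.
  by rewrite mulr0 subrr normr0 (le_trans _ eps_dead) // mulr_ge0.
apply: scaled_diff (strength_near_mate v1) (strength_le v) _ _.
  by rewrite normrM norm_sgn mul1r sinq_le1.
have pn := phase_lt v1.
rewrite -mulrBr normrM norm_sgn mul1r.
rewrite (le_trans (sinq_lip _ _ _)) ?angle01 ?(ltnW pn) ?angleS //.
by rewrite -subr_ge0 angleS invr_ge0.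
Qed.

Variables (phi : T -> int -> R) (center : T -> int -> R) (eta : R).
Hypothesis eta_ge0 : 0 <= eta.
Hypothesis center_near : forall v, present v ->
  `|phi (chain v) (level v) - center (chain v) (piece v)| <= eta.

Definition weightmx := pmx (fun v => phi (chain v) (level v)) id.
Definition centermx := pmx (fun v => center (chain v) (piece v)) id.

Lemma right_mate_inj v v' : present v -> present v' ->
  right (mate v) = right (mate v') -> v = v'.
Proof.
move=> /present_valid v1 /present_valid v2.
move/right_inj; rewrite !valid_mate // => /(_ isT isT) e.
by rewrite -(mateK v1) e mateK.
Qed.

Lemma eps_ge0 : 0 <= eps.
Proof. by apply: le_trans eps_dead; rewrite mulr_ge0. Qed.

Lemma UT_near : let F := Uall *m Tmx - pmx omega right *m Uall in
  bounded_by (2 * eps) F /\ bounded_by (2 * eps) F^T.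
Proof.
rewrite UT_split SU_split opprD addrACA !pmxB /=.
have [b1 b2] : bounded_by eps (pmx (fun v => newcos v - omega v * rcos v) right) /\
    bounded_by eps (pmx (fun v => newcos v - omega v * rcos v) right)^T.
  apply: pmx_bounded eps_ge0 _ => // [v v' /present_valid v1 /present_valid v2|v pv].
    exact: right_inj.
  exact/newcos_near/present_valid.
have [b3 b4] : bounded_by eps
      (pmx (fun v => newsin v - omega (mate v) * rsin v) (right \o mate)) /\
    bounded_by eps
      (pmx (fun v => newsin v - omega (mate v) * rsin v) (right \o mate))^T.
  apply: pmx_bounded eps_ge0 _ => // [v v' pv pv'|v pv]; first exact: right_mate_inj.
  exact/newsin_near/present_valid.
by split; [|rewrite linearD]; apply: bounded_add.
Qed.

Lemma Uswaps_comm : Uon swaps *m weightmx = weightmx *m Uon swaps.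
Proof.
apply: rot_comm_diag (rotation_on swaps_mate) _ => // v pv; case: ifP => [sv _|_].
  by rewrite chain_mate level_mate //; exact: present_valid.
by rewrite eqxx.
Qed.

Lemma Uloops_comm : Uon loops *m centermx = centermx *m Uon loops.
Proof.
apply: rot_comm_diag (rotation_on loops_mate) _ => // v pv; case: ifP => [lv _|_].
  by rewrite chain_mate piece_mate.
by rewrite eqxx.
Qed.

Lemma Tmx_comm : Tmx *m centermx = centermx *m Tmx.
Proof.
rewrite !pmxM //; last exact: nextw_present.
apply: eq_pmx => // v pv /=; rewrite mulrC; congr (_ * _).
have v1 := present_valid pv; have := congr1 (fun c => (chain c, piece c)) (rep_next v1).
by rewrite /= => -[-> ->].
Qed.

Theorem conveyor_normal : exists P B : 'M[R]_d,
  [/\ P *m P^T = P^T *m P, B^T = B & P *m B = B *m P] /\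
  [/\ bounded_by (2 * eps) (P - pmx omega right),
      bounded_by (2 * eps) (P - pmx omega right)^T
    & bounded_by eta (B - weightmx)].
Proof.
set U := Uall; have UU : U^T *m U = 1%:M.
  exact: (@Uon_orth predT (fun=> erefl)).
have UU' : U *m U^T = 1%:M by exact: mulmx1C.
have tU : U^T^T *m U^T = 1%:M by rewrite trmxK.
exists (U *m Tmx *m U^T), (U *m centermx *m U^T).
have conj (X Y : 'M[R]_d) : U *m X *m U^T *m (U *m Y *m U^T) = U *m (X *m Y) *m U^T.
  by rewrite -!mulmxA (mulmxA U^T U) UU mul1mx !mulmxA.
have trconj (X : 'M[R]_d) : (U *m X *m U^T)^T = U *m X^T *m U^T.
  by rewrite !trmx_mul trmxK mulmxA.
split; first by rewrite !trconj !conj Tmx_normal Tmx_comm trmx_pmx_id.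
have [bF bF'] := UT_near.
have eF : U *m Tmx *m U^T - pmx omega right =
    (U *m Tmx - pmx omega right *m U) *m U^T.
  by rewrite mulmxBl -(mulmxA _ U) UU' mulmx1.
split; rewrite ?eF.
- exact: bounded_orthr.
- by rewrite trmx_mul trmxK; apply: bounded_orthl.
have o1 := Uon_orth swaps_mate; have o2 := Uon_orth loops_mate.
have o2' : Uon loops *m (Uon loops)^T = 1%:M by exact: mulmx1C.
have o1' : Uon swaps *m (Uon swaps)^T = 1%:M by exact: mulmx1C.
(* The loop factor commutes with [centermx] and the swap factor with [weightmx], so only one
   difference of diagonal matrices is left. *)
have -> : U *m centermx *m U^T - weightmx =
    Uon swaps *m (centermx - weightmx) *m (Uon swaps)^T.
  rewrite mulmxBr mulmxBl Uswaps_comm -[weightmx *m _ *m _]mulmxA o1' mulmx1.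
  rewrite /U Uall_split trmx_mul -!mulmxA (mulmxA (Uon loops)) Uloops_comm.
  by rewrite -!mulmxA (mulmxA (Uon loops)) o2' mul1mx.
apply: bounded_orthr; first by rewrite trmxK.
apply: bounded_orthl => //.
rewrite pmxB; apply: (pmx_bounded _ _ eta_ge0 _).1 => // v pv.
by rewrite distrC center_near.
Qed.

End Exchange.

End Conveyor.

(** * Passage to complex matrices and their operator norm *)

Section Complexification.
Variables (R : realType) (d : nat).
Local Notation toC := (map_mx (real_complex R)).

Lemma normc_sqr (z : R[i]) : Normc.normc z ^+ 2 = Re z ^+ 2 + Im z ^+ 2.
Proof. by case: z => a b; rewrite /Normc.normc sqr_sqrtr // addr_ge0 ?sqr_ge0. Qed.

Lemma normc_sqrM (z w : R[i]) :
  Normc.normc (z * w) ^+ 2 = Normc.normc z ^+ 2 * Normc.normc w ^+ 2.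
Proof. by rewrite Normc.normcM exprMn. Qed.

Lemma l2norm_sqr (v : 'cV[R[i]]_d) : l2norm v ^+ 2 =
  sqnorm (map_mx (@Re R) v) + sqnorm (map_mx (@Im R) v).
Proof.
rewrite /l2norm sqr_sqrtr; last by apply: sumr_ge0 => i _; exact: sqr_ge0.
by rewrite /sqnorm -big_split; apply: eq_bigr => i _ /=; rewrite normc_sqr !mxE.
Qed.

Lemma Re_toC_mul (A : 'M[R]_d) (v : 'cV[R[i]]_d) :
  map_mx (@Re R) (toC A *m v) = A *m map_mx (@Re R) v.
Proof.
apply/matrixP => i j; rewrite !mxE raddf_sum; apply: eq_bigr => k _.
by rewrite !mxE /=; case: (v k j) => a b /=; rewrite mul0r subr0.
Qed.

Lemma Im_toC_mul (A : 'M[R]_d) (v : 'cV[R[i]]_d) :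
  map_mx (@Im R) (toC A *m v) = A *m map_mx (@Im R) v.
Proof.
apply/matrixP => i j; rewrite !mxE raddf_sum; apply: eq_bigr => k _.
by rewrite !mxE /=; case: (v k j) => a b /=; rewrite mul0r addr0.
Qed.

(** A real matrix acts separately on the real and imaginary parts of a vector, whose squared norms
    add up. *)
Lemma opnorm_le (z : R[i]) (A : 'M[R]_d) (B : R) : 0 <= B -> bounded_by B A ->
  opnorm (z *: toC A) <= Normc.normc z * B.
Proof.
move=> B0 bA.
have z0 : 0 <= Normc.normc z by case: z => a b; exact: sqrtr_ge0.
have zB : 0 <= Normc.normc z * B by exact: mulr_ge0.
apply: ge_sup.
  exists (l2norm (z *: toC A *m 0)); exists 0 => //=.
  rewrite /l2norm big1 ?sqrtr0 ?ler01 // => i _.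
  by rewrite mxE normc_sqr /= expr0n addr0.
move=> _ [v /= v1 <-].
rewrite -(@ler_pXn2r _ 2) ?nnegrE ?sqrtr_ge0 // -scalemxAl.
have -> : l2norm (z *: (toC A *m v)) ^+ 2
    = Normc.normc z ^+ 2 * l2norm (toC A *m v) ^+ 2.
  rewrite /l2norm !sqr_sqrtr; try by apply: sumr_ge0 => i _; exact: sqr_ge0.
  by rewrite mulr_sumr; apply: eq_bigr => i _; rewrite mxE normc_sqrM.
rewrite exprMn; apply: ler_wpM2l; first exact: sqr_ge0.
rewrite l2norm_sqr Re_toC_mul Im_toC_mul (le_trans (lerD (bA _) (bA _))) //.
rewrite -mulrDr -l2norm_sqr ler_piMr ?sqr_ge0 // expr_le1 //; exact: sqrtr_ge0.
Qed.

Lemma real_toC (x : R) : x%:C \is Num.real.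
Proof. by rewrite complex_real. Qed.

Lemma toC_real (A : 'M[R]_d) : toC A \is a realmx.
Proof. by apply/mxOverP => i j; rewrite mxE; exact: real_toC. Qed.

Lemma herm_toC (A : 'M[R]_d) : A^T = A -> toC A \is hermsymmx.
Proof.
move=> sA; apply/is_hermitianmxP; rewrite expr0 scale1r.
apply/matrixP => i j; rewrite -[in LHS]sA !mxE.
by rewrite (CrealP (real_toC _)).
Qed.

Lemma comm_toC (A B : 'M[R]_d) : A *m B = B *m A -> comm_mx (toC A) (toC B).
Proof. by move=> AB; rewrite /comm_mx -!map_mxM AB. Qed.

Lemma normc_half : Normc.normc (2^-1 : R[i]) = 2^-1.
Proof.
rewrite (_ : 2^-1 = (2^-1)%:C); last by rewrite fmorphV rmorph_nat.
by rewrite /Normc.normc /= expr0n addr0 sqrtr_sqr ger0_norm // invr_ge0.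
Qed.

Lemma inv2i : (2 * 'i%C)^-1 = - (2^-1)%:C * 'i%C :> R[i].
Proof.
have h : (2 * 'i%C) * (- (2^-1)%:C * 'i%C) = 1 :> R[i].
  rewrite mulrACA mulrN mulNr -expr2 sqr_i mulrN1 opprK fmorphV rmorph_nat.
  by rewrite divff // pnatr_eq0.
have u : (2 * 'i%C) != 0 :> R[i].
  by apply/eqP => e; move/eqP: h; rewrite e mul0r eq_sym oner_eq0.
by apply: (mulfI u); rewrite divff // h.
Qed.

Lemma normc_inv2i : Normc.normc ((2 * 'i%C)^-1 : R[i]) = 2^-1.
Proof.
rewrite inv2i /Normc.normc /= !(mulr0, mul0r, mulr1, oppr0, subr0, addr0, add0r) expr0n.
by rewrite add0r sqrtr_sqr normrN ger0_norm // invr_ge0.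
Qed.

(** [P] is split into its self-adjoint parts [(P + P^T) / 2] and [(P - P^T) / (2i)], which commute
    because [P] is normal; the factor 1/2 offsets the factor 2 of [bounded_add]. *)
Lemma commuting_triple (P B S D : 'M[R]_d) (e1 e3 : R) :
  0 <= e1 -> 0 <= e3 ->
  P *m P^T = P^T *m P -> B^T = B -> P *m B = B *m P ->
  bounded_by e1 (P - S) -> bounded_by e1 (P - S)^T -> bounded_by e3 (B - D) ->
  exists A1 A2 A3 : 'M[R[i]]_d,
    [/\ comm_mx A1 A2, comm_mx A1 A3 & comm_mx A2 A3] /\
    [/\ A1 \is hermsymmx, A2 \is hermsymmx & A3 \is hermsymmx] /\
    [/\ opnorm (A1 - 2^-1 *: (toC S + toC S^T)) <= e1,
        opnorm (A2 - (2 * 'i%C)^-1 *: (toC S - toC S^T)) <= e1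
      & opnorm (A3 - toC D) <= e3] /\
    [/\ A1 \is a realmx, 'i%C *: A2 \is a realmx & A3 \is a realmx].
Proof.
move=> e10 e30 nP sB PB b1 b1' b3.
have PtB : P^T *m B = B *m P^T.
  by rewrite -sB -!trmx_mul -PB.
exists (toC (2^-1 *: (P + P^T))), ((2 * 'i%C)^-1 *: toC (P - P^T)), (toC B).
have e2 : 2^-1 * (2 * e1) = e1 by field.
have e0 : 0 <= 2 * e1 by rewrite mulr_ge0.
split; last split; last split.
- split.
  + rewrite /comm_mx -scalemxAr -scalemxAl -!map_mxM; congr (_ *: map_mx _ _).
    rewrite -scalemxAl -scalemxAr !mulmxBr !mulmxBl !mulmxDl !mulmxDr nP.
    by congr (_ *: _); rewrite !opprD !addrA addrAC.
  + by apply: comm_toC; rewrite -scalemxAl -scalemxAr mulmxDl mulmxDr PB PtB.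
  + rewrite /comm_mx -scalemxAl -scalemxAr -!map_mxM.
    by rewrite mulmxBl mulmxBr PB PtB.
- split.
  + by apply: herm_toC; rewrite linearZ linearD /= trmxK addrC.
  + apply/is_hermitianmxP; rewrite expr0 scale1r; apply/matrixP => i j.
    rewrite !mxE rmorphM /= (CrealP (real_toC _)) inv2i.
    rewrite -[P i j - _]opprB rmorphN mulrN -mulNr; congr (_ * _).
    rewrite rmorphM /= rmorphN /= (CrealP (real_toC _)).
    by rewrite complexiE conjCi mulrN.
  + exact: herm_toC.
- split.
  + have -> : toC (2^-1 *: (P + P^T)) - 2^-1 *: (toC S + toC S^T)
        = 2^-1 *: toC ((P - S) + (P - S)^T).
      rewrite map_mxZ /= fmorphV rmorph_nat -scalerBr; congr (_ *: _).
      by rewrite linearB /= !map_mxD !map_mxN opprD addrACA.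
    rewrite -[leRHS]e2 -normc_half; apply: opnorm_le => //.
    exact: bounded_add.
  + have -> : (2 * 'i%C)^-1 *: toC (P - P^T) - (2 * 'i%C)^-1 *: (toC S - toC S^T)
        = (2 * 'i%C)^-1 *: toC ((P - S) + (-1) *: (P - S)^T).
      rewrite -scalerBr; congr (_ *: _).
      apply/matrixP => i j; rewrite !mxE !(rmorphB, rmorphD, rmorphN, rmorphM) rmorph1.
      by ring.
    rewrite -[leRHS]e2 -normc_inv2i; apply: opnorm_le => //.
    apply: bounded_add => // v; have := bounded_scale (-1) b1' v.
    by rewrite mulN1r sqrrN.
  + rewrite -map_mxB -[toC _]scale1r -[leRHS]mul1r -Normc.normc1.
    exact: opnorm_le.
- split; [exact: toC_real | | exact: toC_real].
  have -> : 'i%C *: ((2 * 'i%C)^-1 *: toC (P - P^T)) = toC (2^-1 *: (P - P^T)).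
    rewrite scalerA inv2i mulrCA -expr2 sqr_i mulrN1 opprK.
    by rewrite map_mxZ.
  exact: toC_real.
Qed.

End Complexification.

(** * The cell with a given row and level *)

Section Decode.
Variables (T : eqType) (M h : nat).
Hypotheses (M_gt0 : (0 < M)%N) (h_gt0 : (0 < h)%N).

(** Row [u] consists of the stages [M - 1 - u] and [M + u], of opposite parities; the layer number
    [l = 2b + s] decides between them. *)
Definition cell_at (g : T) (u : nat) (z : int) : cell T :=
  let l := (z %/ (2 * h)%:Z)%Z in
  let s := if (2 %| l - (M.-1 - u)%N%:Z)%Z then (M.-1 - u)%N else (M + u)%N in
  (g, ((l - s%:Z) %/ 2)%Z, s, `|(z %% (2 * h)%:Z)%Z|%N).

Lemma cell_at_valid g u z : (u < M)%N -> valid M h (cell_at g u z).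
Proof.
move=> uM; have h2 : (2 * h)%:Z != 0 by lia.
have := ltz_pmod z (ltac:(lia) : 0 < (2 * h)%:Z).
have := modz_ge0 z h2; rewrite /valid /cell_at /=.
by move: (z %% _)%Z => q; case: ifP; lia.
Qed.

Lemma cell_at_row g u z : (u < M)%N -> row_of M (stage (cell_at g u z)) = u.
Proof. by move=> uM; rewrite /row_of /cell_at /=; repeat case: ifP; lia. Qed.

Lemma cell_at_level g u z : (u < M)%N -> level h (cell_at g u z) = z.
Proof.
move=> uM; have h2 : (2 * h)%:Z != 0 by lia.
rewrite /level /cell_at /= [RHS](divz_eq z (2 * h)%:Z).
rewrite gez0_abs ?modz_ge0 //; congr (_ * _ + _).
move: (z %/ _)%Z => l.
case: ifP => e.
  have := divzK e; lia.
have e' : (2 %| l - (M + u)%N%:Z)%Z.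
  have -> : l - (M + u)%N%:Z = l - (M.-1 - u)%N%:Z - 1 - 2 * u%:Z by lia.
  by lia.
have := divzK e'; lia.
Qed.

Lemma cell_inj (v v' : cell T) : valid M h v -> valid M h v' -> chain v = chain v' ->
  row_of M (stage v) = row_of M (stage v') -> level h v = level h v' -> v = v'.
Proof.
case: v v' => [[[g b] s] q] [[[g' b'] s'] q']; rewrite /valid /level /= => v1 v2 -> rs lv.
have h2 : (2 * h)%:Z != 0 by lia.
have q1 : q = q'.
  have := congr1 (fun z => (z %% (2 * h)%:Z)%Z) lv.
  rewrite !modzMDl !modz_small; lia.
have := congr1 (fun z => (z %/ (2 * h)%:Z)%Z) lv.
rewrite !divzMDl // !divz_small; try lia.
rewrite !addr0 q1 => bs.
move: rs; rewrite /row_of => rs.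
have ss : s = s' by move: rs; repeat case: ifP; lia.
by apply: cellE => //; lia.
Qed.

End Decode.

(** * Entries of a direct sum of irreducible representations *)

Section DirectSumEntries.
Variables (R : realType) (N m : nat) (k n : 'I_m -> nat).
Local Notation d := (dimS k n).

Definition irrep (x : 'I_d) : 'I_m := tagnat.sig1 x.
Definition copy (x : 'I_d) : nat := tagnat.sig1 (tagnat.sig2 x).
Definition height (x : 'I_d) : nat := tagnat.sig2 (tagnat.sig2 x).

Lemma copy_lt x : (copy x < n (irrep x))%N.
Proof. exact: (ltn_ord (tagnat.sig1 (tagnat.sig2 x))). Qed.

Lemma height_le x : (height x <= k (irrep x))%N.
Proof. exact: (ltn_ord (tagnat.sig2 (tagnat.sig2 x))). Qed.

Lemma dsum_index_inj x y : irrep x = irrep y -> copy x = copy y -> height x = height y ->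
  x = y.
Proof.
rewrite /copy /height => e1 e2 e3.
rewrite -[x]tagnat.sig2K -[y]tagnat.sig2K.
rewrite -[tagnat.sig2 x]tagnat.sig2K -[tagnat.sig2 y]tagnat.sig2K.
rewrite /irrep in e1 e2 e3.
move: (tagnat.sig2 (tagnat.sig2 x)) (tagnat.sig2 (tagnat.sig2 y)) e3.
move: (tagnat.sig1 (tagnat.sig2 x)) (tagnat.sig1 (tagnat.sig2 y)) e2.
move: (tagnat.sig1 x) (tagnat.sig1 y) e1 => r r' e; subst r'.
move=> c c' /val_inj e; subst c'.
by move=> a a' /val_inj ->.
Qed.

Definition dsum_index (r : 'I_m) (c : 'I_(n r)) (a : 'I_(k r).+1) : 'I_d :=
  @tagnat.Rank _ (fun r => \sum_(c < n r) (k r).+1)%N r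
    (@tagnat.Rank _ (fun=> (k r).+1) c a).

Lemma dsum_index_split x : exists r (c : 'I_(n r)) (a : 'I_(k r).+1), x = dsum_index c a.
Proof.
exists (tagnat.sig1 x), (tagnat.sig1 (tagnat.sig2 x)), (tagnat.sig2 (tagnat.sig2 x)).
by rewrite /dsum_index !tagnat.sig2K.
Qed.

Lemma irrep_dsum_index r (c : 'I_(n r)) (a : 'I_(k r).+1) : irrep (dsum_index c a) = r.
Proof. exact: tagnat.Rank1K. Qed.

(** The type of the second component depends on the first; mapping both into a fixed type [X] avoids
    a cast. *)
Lemma sig_Rank (X : Type) (p : nat) (p_ : 'I_p -> nat) (f : forall i, 'I_(p_ i) -> X)
    i (a : 'I_(p_ i)) :
  f (tagnat.sig1 (tagnat.Rank i a)) (tagnat.sig2 (tagnat.Rank i a)) = f i a.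
Proof. by rewrite /tagnat.sig1 /tagnat.sig2 /tagnat.Rank tagnat.rankK. Qed.

Lemma copy_dsum_index r (c : 'I_(n r)) (a : 'I_(k r).+1) : copy (dsum_index c a) = c.
Proof.
rewrite /copy /dsum_index (sig_Rank (fun r (y : 'I_(\sum_(c < n r) (k r).+1)) =>
  nat_of_ord (tagnat.sig1 y))).
by rewrite tagnat.Rank1K.
Qed.

Lemma height_dsum_index r (c : 'I_(n r)) (a : 'I_(k r).+1) : height (dsum_index c a) = a.
Proof.
rewrite /height /dsum_index (sig_Rank (fun r (y : 'I_(\sum_(c < n r) (k r).+1)) =>
  nat_of_ord (tagnat.sig2 y))).
exact: (@sig_Rank nat _ (fun=> (k r).+1) (fun _ y => nat_of_ord y)).
Qed.

Lemma dsum_index_exists (r : 'I_m) (c a : nat) : (c < n r)%N -> (a <= k r)%N ->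
  exists x, [/\ irrep x = r, copy x = c & height x = a].
Proof.
move=> cn ak; exists (dsum_index (Ordinal cn) (Ordinal (ak : (a < (k r).+1)%N))).
by rewrite irrep_dsum_index copy_dsum_index height_dsum_index.
Qed.

Lemma mxdiag_Rank (S : nmodType) (p : nat) (p_ : 'I_p -> nat)
    (B : forall i, 'M[S]_(p_ i)) i (a b : 'I_(p_ i)) :
  mxdiag B (tagnat.Rank _ a) (tagnat.Rank _ b) = B i a b.
Proof. by rewrite -(submxblock_diag B i) [RHS]mxE. Qed.

Lemma mxdiag_neq (S : nmodType) (p : nat) (p_ : 'I_p -> nat)
    (B : forall i, 'M[S]_(p_ i)) i j (a : 'I_(p_ i)) (b : 'I_(p_ j)) :
  i != j -> mxdiag B (tagnat.Rank _ a) (tagnat.Rank _ b) = 0.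
Proof.
move=> ij; rewrite /mxdiag /mxblock mxE.
have -> : (tagnat.sig1 (tagnat.Rank i a) == tagnat.sig1 (tagnat.Rank j b)) = false.
  by rewrite !tagnat.Rank1K; exact: negPf.
by rewrite mxE.
Qed.

Definition same (x y : 'I_d) := (irrep x == irrep y) && (copy x == copy y).

Lemma scaled_dsumE (F : forall e, 'M[R[i]]_e.+1) (f : nat -> nat -> nat -> R[i])
    (x y : 'I_d) :
  (forall e a b, F e a b = f e a b) ->
  scaled_dsum N k n F x y =
    N%:R^-1 * (if same x y then f (k (irrep y)) (height x) (height y) else 0).
Proof.
move=> Ff; rewrite mxE; congr (_ * _).
have [r [c [a ->]]] := dsum_index_split x; have [r' [c' [a' ->]]] := dsum_index_split y.
rewrite /same !irrep_dsum_index !copy_dsum_index !height_dsum_index.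
case: (eqVneq r r') => [e|ne]; last by rewrite mxdiag_neq.
subst r'; rewrite mxdiag_Rank; have [e|ne] := eqVneq c c'.
  by subst c'; rewrite eqxx mxdiag_Rank Ff.
by rewrite mxdiag_neq // (negPf (ne : (c : nat) != c')).
Qed.

End DirectSumEntries.

(** * The scaled ladder and weight operators as real matrices *)

Section SpinSums.
Variables (R : realType) (N m : nat) (k n : 'I_m -> nat).
Local Notation d := (dimS k n).
Local Notation toC := (map_mx (real_complex R)).
Implicit Types (K a : nat) (x y : 'I_d).

Definition ladder K a : R := ladder_coef K (weight R K a).

Definition raising K (a b : nat) : R := if a == b.+1 then ladder K b else 0.

Definition raisemx : 'M[R]_d := \matrix_(x, y) (N%:R^-1 *
  (if same x y then raising (k (irrep y)) (height x) (height y) else 0)).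

Definition weightsmx : 'M[R]_d := \matrix_(x, y) (N%:R^-1 *
  (if same x y then if height x == height y
                    then weight R (k (irrep y)) (height y) else 0 else 0)).

Lemma sameC x y : same x y = same y x.
Proof. by rewrite /same eq_sym [copy _ == _]eq_sym. Qed.

Lemma spin_plusE e (a b : 'I_e.+1) : spin_plus R e a b = (raising e a b)%:C.
Proof. by rewrite mxE /raising; case: ifP. Qed.

Lemma spin_minusE e (a b : 'I_e.+1) : spin_minus R e a b = (raising e b a)%:C.
Proof. by rewrite mxE mxE spin_plusE (CrealP (real_toC _)). Qed.

Lemma raisemx_tr x y : raisemx^T x y = N%:R^-1 *
  (if same x y then raising (k (irrep y)) (height y) (height x) else 0).
Proof. by rewrite !mxE sameC; case: ifP => // /andP[/eqP -> _]. Qed.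

Lemma scaled_dsum_spin1 :
  scaled_dsum N k n (spin1 R) = 2^-1 *: (toC raisemx + toC raisemx^T).
Proof.
apply/matrixP => x y; rewrite (@scaled_dsumE _ _ _ _ _ _
  (fun e a b => 2^-1 * ((raising e a b)%:C + (raising e b a)%:C))).
  rewrite [RHS]mxE [X in _ = _ * X]mxE [toC raisemx _ _]mxE [toC _ _ _]mxE raisemx_tr mxE.
  by case: ifP => _; rewrite !rmorphM fmorphV rmorph_nat ?rmorph0 /=; ring.
by move=> e a b; rewrite mxE [X in _ * X = _]mxE spin_plusE spin_minusE.
Qed.

Lemma scaled_dsum_spin2 :
  scaled_dsum N k n (spin2 R) = (2 * 'i%C)^-1 *: (toC raisemx - toC raisemx^T).
Proof.
apply/matrixP => x y; rewrite (@scaled_dsumE _ _ _ _ _ _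
  (fun e a b => (2 * 'i%C)^-1 * ((raising e a b)%:C - (raising e b a)%:C))).
  rewrite [RHS]mxE [X in _ = _ * X]mxE [toC raisemx _ _]mxE [X in _ = _ * (_ + X)]mxE.
  rewrite [toC _ _ _]mxE raisemx_tr mxE.
  by case: ifP => _; rewrite !rmorphM fmorphV rmorph_nat ?rmorph0 /=; ring.
move=> e a b; rewrite mxE [X in _ * X = _]mxE [X in _ * (_ + X) = _]mxE.
by rewrite spin_plusE spin_minusE.
Qed.

Lemma scaled_dsum_spin3 : scaled_dsum N k n (spin3 R) = toC weightsmx.
Proof.
apply/matrixP => x y.
rewrite (@scaled_dsumE _ _ _ _ _ _
  (fun e a b => (if a == b then weight R e b else 0)%:C)).
  by rewrite !mxE; case: ifP => _; rewrite rmorphM fmorphV rmorph_nat ?rmorph0.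
by move=> e a b; rewrite mxE; case: (eqVneq a b) => [->|ne];
  rewrite ?eqxx // (negPf (ne : (a : nat) != b)).
Qed.

Lemma ladderE K a :
  ladder K a = Num.sqrt ((K%:R - a%:R) * (a%:R + 1)).
Proof. by rewrite /ladder /ladder_coef /weight /spin; congr Num.sqrt; field. Qed.

(** Arithmetic-geometric mean inequality for [K - a] and [a + 1]. *)
Lemma ladder_le K a : ladder K a <= (K%:R + 1) / 2.
Proof.
have h : 0 <= (K%:R + 1) / 2 :> R by rewrite divr_ge0 // addr_ge0 // ler0n.
rewrite ladderE -[leRHS]ger0_norm // -sqrtr_sqr ler_wsqrtr //.
have := sqr_ge0 (K%:R - 2 * a%:R - 1 : R); move: (K%:R) (a%:R) => K' a'; nra.
Qed.

End SpinSums.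

(** * Variation of the ladder coefficients *)

Lemma sqrt_le_add (R : rcfType) (f f' e : R) : 0 <= e -> f <= f' + e ^+ 2 ->
  Num.sqrt f <= Num.sqrt f' + e.
Proof.
move=> e0 ff; have s0 := sqrtr_ge0 f'.
have se : 0 <= Num.sqrt f' + e by exact: addr_ge0.
rewrite -[leRHS]ger0_norm // -sqrtr_sqr ler_wsqrtr // (le_trans ff) //.
have [f0|f0] := leP 0 f'.
  by rewrite sqrrD sqr_sqrtr // -addrA lerD2l lerDr mulrn_wge0 // mulr_ge0.
(* Here the square root has its default value 0. *)
rewrite ltr0_sqrtr // add0r; lra.
Qed.

(* With lambda = k / 2 and i = h - lambda, (k - h) (h + 1) is
   lambda (lambda + 1) - i (i + 1). *)
Lemma ladder_variation (R : realFieldType) (k k' h h' N L W : R) :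
  0 <= k' -> k <= N -> k' <= N -> 0 <= h -> h <= k ->
  k' <= k + 2 * L -> k <= k' + 2 * L ->
  `|(h - k / 2) - (h' - k' / 2)| <= W ->
  (k - h) * (h + 1) <= (k' - h') * (h' + 1) + (L * (N + 1) + W * (N + W + 1)).
Proof.
move=> k0' kN kN' h0 hk k1 k2; set l := k / 2; set l' := k' / 2.
have -> : k = 2 * l by rewrite /l; field.
have -> : k' = 2 * l' by rewrite /l'; field.
set i := h - l; set i' := h' - l'; move=> iW.
have -> : (2 * l - h) * (h + 1) = l * (l + 1) - i * (i + 1) by rewrite /i; ring.
have -> : (2 * l' - h') * (h' + 1) = l' * (l' + 1) - i' * (i' + 1) by rewrite /i'; ring.
have i1 : `|i| <= N / 2.
  by rewrite ler_norml /i /l; apply/andP; split; lra.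
have a1 : (l - l') * (l + l' + 1) <= L * (N + 1).
  have lL : l - l' <= L by rewrite /l /l'; lra.
  have lN : l + l' + 1 <= N + 1 by rewrite /l /l'; lra.
  have l0 : 0 <= l + l' + 1 by rewrite /l /l'; lra.
  have L0 : 0 <= L by lra.
  by apply: le_trans (ler_wpM2l L0 lN); apply: ler_wpM2r.
(* The second point may lie outside its representation, so [i'] is controlled only through [i] and
   [W]. *)
have a2 : (i' - i) * (i + i' + 1) <= W * (N + W + 1).
  apply: (le_trans (ler_norm _)); rewrite normrM ler_pM //; first by rewrite distrC.
  move: iW i1; rewrite !ler_norml => /andP[? ?] /andP[? ?].
  by apply/andP; split; lra.
have : l * (l + 1) - i * (i + 1) =
   l' * (l' + 1) - i' * (i' + 1) + ((l - l') * (l + l' + 1) + (i' - i) * (i + i' + 1)) by ring.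
by move=> ->; rewrite lerD2l lerD.
Qed.

(** * Chains of representations and their embedding in the strip *)

Section Chains.
Variables (R : realType) (N m : nat) (k n : 'I_m -> nat).
Variables (istar st G L : nat).
Hypothesis G_gt0 : (0 < G)%N.
Hypothesis stG : (st * G = 2 * L)%N.
Hypothesis k_affine : forall r s : 'I_m, (k r + st * s = k s + st * r)%N.
Hypothesis k_le : forall r, (k r <= N)%N.
Hypothesis n_mono : forall i j : 'I_m, (istar <= i)%N -> j = (i + G)%N :> nat ->
  (n j <= n i)%N.

Local Notation d := (dimS k n).
Local Notation cell := (cell (nat * nat)%type).
Implicit Types (x y : 'I_d) (r : 'I_m) (v : cell).

(* The summands of index r >= istar are grouped by r - istar modulo G, where the
   spins of r and r + G differ by L; each r < istar is a chain by itself. The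
   spin step is st / 2. *)
Definition base (r : nat) : nat :=
  if (r < istar)%N then r else (istar + (r - istar) %% G)%N.

(** A chain is a copy number [c] with a class [b]; rows are counted downwards from its last
    representation. *)
Definition top (c b : nat) : nat :=
  \max_(r : 'I_m | (base r == b) && (c < n r)%N) r.

(* The number of representations above x in its chain. *)
Definition depth x : nat := ((top (copy x) (base (irrep x)) - irrep x) %/ G)%N.

(** The weight, plus 1/2 for half-integer spins. This shift is the same for a whole chain, so equal
    abscissas mean equal weights. *)
Definition pos x : int := (height x)%:Z - ((k (irrep x))./2)%:Z.

Lemma top_attained r c : (c < n r)%N ->
  exists t : 'I_m, [/\ top c (base r) = t, base t = base r & (c < n t)%N].
Proof.
move=> cn.
have [|t /andP[/eqP bt ct] e] := @eq_bigmax_cond 'I_m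
    (fun r' => (base r' == base r) && (c < n r')%N) (fun r' => nat_of_ord r').
  by apply/card_gt0P; exists r; rewrite unfold_in /= eqxx.
by exists t; rewrite /top e.
Qed.

Lemma top_ge r c : (c < n r)%N -> (r <= top c (base r))%N.
Proof.
move=> cn; rewrite /top.
by apply: (@leq_bigmax_cond _ _ (fun r' : 'I_m => nat_of_ord r') r); rewrite eqxx.
Qed.

Lemma base_gap (r t : nat) : (r <= t)%N -> base t = base r ->
  t = (r + (t - r) %/ G * G)%N.
Proof.
move=> rt; rewrite /base; case: (ltnP t istar) => ti; case: (ltnP r istar) => ri.
- by move=> ->; rewrite subnn div0n addn0.
- lia.
- by have := ltn_pmod (t - istar) G_gt0; lia.
- move=> /addnI e; have : (G %| t - r)%N.
    have -> : (t - r = t - istar - (r - istar))%N by lia.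
    by rewrite -eqn_mod_dvd; [apply/eqP | lia].
  by move/divnK ->; lia.
Qed.

Lemma baseD r j : (istar <= r)%N -> base (r + j * G) = base r.
Proof.
move=> ir; rewrite /base !ltnNge ir (leq_trans ir (leq_addr _ _)) /=.
by congr (_ + _)%N; rewrite addnC -addnBA // modnMDl.
Qed.

Lemma depth_top x : top (copy x) (base (irrep x)) = (irrep x + depth x * G)%N.
Proof.
have cx := copy_lt x; have [t [e bt _]] := top_attained cx.
by rewrite /depth e; apply: base_gap bt; rewrite -e top_ge.
Qed.

Lemma chain_inj x y : copy x = copy y -> base (irrep x) = base (irrep y) ->
  depth x = depth y -> irrep x = irrep y.
Proof.
move=> cxy bxy dxy; apply: val_inj => /=.
by have := depth_top x; have := depth_top y; rewrite cxy bxy dxy; lia.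
Qed.

(** Along a class [k] changes by multiples of the even number [st * G = 2 * L]. *)
Lemma k_base r r' : base r = base r' -> odd (k r) = odd (k r').
Proof.
wlog rr : r r' / (r <= r')%N => [H|].
  by case: (leqP r r') => [/H//|/ltnW /H h1 /esym /h1 ->].
move=> /esym e; have := base_gap rr e; have := k_affine r r'.
move: (_ %/ _)%N => t; move=> a1 a2; have : k r' = (k r + t * (2 * L))%N.
  by rewrite -stG; move: a1; rewrite a2 mulnDr; lia.
by move=> ->; rewrite oddD oddM oddM /= !andbF addbF.
Qed.

(** Each row upwards adds [2 * L] to [k], which is still at most [N] at the top. *)
Lemma depth_le x : (2 * L * depth x <= N)%N.
Proof.
have [t [et _ _]] := top_attained (copy_lt x); have := depth_top x; rewrite et => e.
have := k_affine (irrep x) t; rewrite e mulnDr (mulnC (depth x)) mulnA stG.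
by have := k_le t; lia.
Qed.

Variables (M h : nat).
Hypotheses (M_gt0 : (0 < M)%N) (h_gt0 : (0 < h)%N) (N_gt0 : (0 < N)%N).

Definition kappa x : cell :=
  cell_at M h (copy x, base (irrep x)) (depth x) (pos x).

Hypothesis depth_lt : forall x, (depth x < M.-1)%N.

Lemma depth_ltM x : (depth x < M)%N.
Proof. by have := depth_lt x; lia. Qed.

Lemma kappa_valid x : valid M h (kappa x).
Proof. by apply: cell_at_valid; rewrite ?depth_ltM. Qed.

Lemma kappa_row x : row_of M (stage (kappa x)) = depth x.
Proof. by apply: cell_at_row; rewrite ?depth_ltM. Qed.

Lemma kappa_level x : level h (kappa x) = pos x.
Proof. by apply: cell_at_level; rewrite ?depth_ltM. Qed.

Lemma kappa_inj : injective kappa.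
Proof.
move=> x y e; have [c b] : chain (kappa x) = chain (kappa y) by rewrite e.
have r : depth x = depth y by rewrite -!kappa_row e.
have z : pos x = pos y by rewrite -!kappa_level e.
have i := chain_inj c b r; apply: dsum_index_inj => //.
by move: z; rewrite /pos i; lia.
Qed.

Definition strong x : R := N%:R^-1 * ladder R (k (irrep x)) (height x).

Definition omega v : R :=
  if [pick x | kappa x == v] is Some x then strong x else 0.

Lemma omega_kappa x : omega (kappa x) = strong x.
Proof.
rewrite /omega; case: pickP => [y /eqP /kappa_inj -> //|/(_ x)].
by rewrite eqxx.
Qed.

Lemma omega_absent v : ~~ present kappa v -> omega v = 0.
Proof.
rewrite /omega; case: pickP => [y e|//]; case/negP.
by apply/existsP; exists y.
Qed.

Lemma raisemx_pmx : raisemx R N k n = pmx kappa omega (right M h).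
Proof.
apply/matrixP => x y; rewrite !mxE omega_kappa /strong /raising.
have eqv : (right M h (kappa y) == kappa x) = same x y && (height x == (height y).+1).
  apply/eqP/andP => [e|[/andP[/eqP i /eqP c] /eqP z]].
    have [c b] : chain (kappa y) = chain (kappa x).
      by rewrite -e right_chain.
    have u : depth y = depth x.
      by rewrite -!kappa_row -(right_row M_gt0 h_gt0 (kappa_valid y)) e.
    have i := chain_inj c b u.
    have l : pos x = pos y + 1.
      by rewrite -!kappa_level -e right_level ?kappa_valid.
    by rewrite /same i c !eqxx; split=> //; move: l; rewrite /pos i; lia.
  apply: (cell_inj M_gt0 h_gt0); rewrite ?kappa_valid ?valid_right ?kappa_valid //.
  - by rewrite right_chain /kappa /= i c.
  - by rewrite right_row ?kappa_valid // !kappa_row /depth i c.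
  - by rewrite right_level ?kappa_valid // !kappa_level /pos i z; lia.
rewrite eqv; case: same => /=; last by rewrite mulr0 mulr0n.
by case: ifP; rewrite ?mulr1n ?mulr0.
Qed.

Definition parity (b : nat) : R :=
  if [pick r : 'I_m | base r == b] is Some r then (odd (k r))%:R / 2 else 0.

Lemma parity_base r : parity (base r) = (odd (k r))%:R / 2.
Proof.
rewrite /parity; case: pickP => [r' /eqP /k_base ->//|/(_ r)].
by rewrite eqxx.
Qed.

Definition phi (g : nat * nat) (z : int) : R := N%:R^-1 * (z%:~R - parity g.2).

Lemma weight_pos x : weight R (k (irrep x)) (height x) =
  (pos x)%:~R - (odd (k (irrep x)))%:R / 2.
Proof.
rewrite /weight /spin /pos intrB -!pmulrn -[in LHS](odd_double_half (k (irrep x))).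
by rewrite natrD -mul2n natrM; field.
Qed.

Lemma weightsmx_pmx : weightsmx R N k n = weightmx h kappa phi.
Proof.
apply/matrixP => x y; rewrite !mxE kappa_level /=.
have -> : (kappa y == kappa x) = same x y && (height x == height y).
  rewrite (inj_eq kappa_inj); apply/eqP/andP => [->|]; first by rewrite /same !eqxx.
  by case=> /andP[/eqP i /eqP c] /eqP z; apply: dsum_index_inj; rewrite ?i ?c ?z.
case: same => /=; last by rewrite mulr0 mulr0n.
case: ifP; rewrite ?mulr1n ?mulr0n ?mulr0 // => _.
by rewrite /phi parity_base weight_pos.
Qed.

(** Midpoint of a piece, whose levels start at [4hb] and span [4Mh] values. *)
Definition center (g : nat * nat) (b : int) : R :=
  N%:R^-1 * (4 * h%:R * b%:~R + 2 * M%:R * h%:R).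

Lemma center_near v : present kappa v ->
  `|phi (chain v) (level h v) - center (chain v) (piece v)|
    <= N%:R^-1 * (2 * M%:R * h%:R + 1 / 2).
Proof.
case/presentP => x xv; have := kappa_valid x; rewrite xv => v1.
have p01 : 0 <= parity (chain v).2 <= 1 / 2.
  by rewrite -xv /= parity_base; case: odd; rewrite /= ?mulr1n ?mulr0n; lra.
rewrite /phi /center -mulrBr normrM ger0_norm ?invr_ge0 ?ler0n //.
apply: ler_wpM2l; first by rewrite invr_ge0 ler0n.
case: v v1 {xv} p01 => [[[g b] s] q] /andP[/= s1 q1] p01.
rewrite /level /= intrD intrM intrD intrM -!pmulrn natrM.
have s2 : s%:R * 2 * h%:R + q%:R + 1 <= 4 * M%:R * h%:R :> R.
  have : (s * 2 * h + q + 1 <= 4 * M * h)%N by nia.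
  by rewrite -(ler_nat R) !natrD !natrM.
have s0 : 0 <= s%:R * 2 * h%:R + q%:R :> R by rewrite addr_ge0 ?mulr_ge0.
have e : (2%:~R * b%:~R + s%:R) * (2 * h%:R) + q%:R - parity g.2
   - (4 * h%:R * b%:~R + 2 * M%:R * h%:R) =
   (s%:R * 2 * h%:R + q%:R) - 2 * M%:R * h%:R - parity g.2 :> R by ring.
rewrite e ler_norml; move: s0 s2; move: (_ + q%:R) => Q.
have -> : 4 * M%:R * h%:R = 2 * (2 * M%:R * h%:R) :> R by ring.
move: (2 * M%:R * h%:R) => P; lra.
Qed.

Variable del : R.
Hypothesis del_ge0 : 0 <= del.
Hypothesis strong_small : forall x, (irrep x < istar + G)%N -> strong x <= del.
Hypothesis variation : L%:R * (N%:R + 1) +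
  (4 * M * h)%:R * (N%:R + (4 * M * h)%:R + 1) <= (N%:R * del) ^+ 2 :> R.

Lemma omega_ge0 v : 0 <= omega v.
Proof.
rewrite /omega; case: pickP => // x _.
by rewrite mulr_ge0 ?invr_ge0 ?ler0n // sqrtr_ge0.
Qed.

Lemma n_chain c (i j : 'I_m) t : (istar <= i)%N -> j = (i + t * G)%N :> nat ->
  (c < n j)%N -> (c < n i)%N.
Proof.
elim: t i => [|t IH] i ii e cj.
  by rewrite (_ : i = j) //; apply: val_inj; rewrite /= e; lia.
have lt : (i + G < m)%N by have := ltn_ord j; rewrite e mulSn; lia.
apply: leq_trans (n_mono ii (erefl : Ordinal lt = (i + G)%N :> nat)).
by apply: (IH (Ordinal lt)); rewrite //= ?e ?mulSn; lia.
Qed.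

(** One step down from index [istar + G] or higher still ends at [istar] or above, where the
    multiplicities are monotone, so the copy exists in that row too. *)
Lemma near_row x (u : nat) : (istar + G <= irrep x)%N ->
  (u <= (depth x).+1)%N -> (depth x <= u.+1)%N ->
  exists r : 'I_m, [/\ base r = base (irrep x), (copy x < n r)%N,
    top (copy x) (base (irrep x)) = (r + u * G)%N &
    (k r <= k (irrep x) + 2 * L)%N /\ (k (irrep x) <= k r + 2 * L)%N].
Proof.
move=> ix ux xu; have cx := copy_lt x; have tx := depth_top x.
have [t [et _ ct]] := top_attained cx.
have im : ((irrep x + depth x * G) < m)%N by rewrite -tx et ltn_ord.
have [r er] : exists r : 'I_m, (r + u * G)%N = (irrep x + depth x * G)%N /\ (istar <= r)%N.
  have rm : (irrep x + depth x * G - u * G < m)%N by lia.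
  exists (Ordinal rm) => /=.
  have : (u * G <= G + depth x * G)%N by rewrite -mulSn leq_mul2r ux orbT.
  by lia.
case: er => er ir.
exists r; split.
- have [e|e] := leqP u (depth x).
    have -> : (r : nat) = (irrep x + (depth x - u) * G)%N.
      by rewrite mulnBl; have := leq_mul e (leqnn G); lia.
    by rewrite baseD //; lia.
  have -> : (irrep x : nat) = (r + (u - depth x) * G)%N.
    by rewrite mulnBl; have := leq_mul (ltnW e) (leqnn G); lia.
  by rewrite baseD.
- by apply: (@n_chain _ r t u) => //; rewrite -et tx er.
- by rewrite tx er.
have := k_affine r (irrep x).
have h1 : (u * G <= G + depth x * G)%N by rewrite -mulSn leq_mul2r ux orbT.
have h2 : (depth x * G <= G + u * G)%N by rewrite -mulSn leq_mul2r xu orbT.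
have h3 : (r <= irrep x + G)%N by lia.
have h4 : (irrep x <= r + G)%N by lia.
have := leq_mul (leqnn st) h3; have := leq_mul (leqnn st) h4.
by rewrite !mulnDr stG; lia.
Qed.

(** Low in a chain the coefficient is itself at most [del]; elsewhere the row of [v'] holds a
    representation whose ladder formula can be compared at nearby weights. *)
Lemma omega_drop v v' : valid M h v -> valid M h v' -> chain v = chain v' ->
  (row_of M (stage v) <= (row_of M (stage v')).+1)%N ->
  (row_of M (stage v') <= (row_of M (stage v)).+1)%N ->
  `|level h v - level h v'| <= (4 * M * h)%:Z -> omega v - omega v' <= del.
Proof.
move=> v1 v1' cvv r1 r2 lvv.
have [/presentP[x xv]|/omega_absent ->] := boolP (present kappa v); last first.
  by rewrite sub0r (le_trans _ del_ge0) // oppr_le0 omega_ge0.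
subst v; rewrite omega_kappa; have w0 := omega_ge0 v'.
have [/strong_small small|ix] := ltnP (irrep x) (istar + G).
  by rewrite (le_trans _ small) // lerBlDr lerDl.
rewrite !kappa_row kappa_level in r1 r2 lvv.
have [r [br cr tr [k1 k2]]] := near_row ix r2 r1.
set z := level h v' in lvv *; set K := k r; set a : int := z + (K./2)%:Z.
(* Outside the representation the radicand is nonpositive and its root 0, so one formula covers
   present and absent cells. *)
have wv' : N%:R^-1 * Num.sqrt ((K%:R - a%:~R) * (a%:~R + 1)) <= omega v'.
  have [/andP[a0 aK]|out] := boolP (0 <= a <= K%:Z); last first.
    rewrite ler0_sqrtr ?mulr0 //.
    move: out; rewrite negb_and -!ltNge => /orP[a0|aK].
      have a1 : a%:~R + 1 <= 0 :> R by rewrite -[1]/(1%:~R) -intrD lerz0; lia.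
      have a2 : 0 <= K%:R - a%:~R :> R by rewrite pmulrn -intrB ler0z; lia.
      by rewrite mulr_ge0_le0.
    have a1 : 0 <= a%:~R + 1 :> R by rewrite -[1]/(1%:~R) -intrD ler0z; lia.
    have a2 : K%:R - a%:~R <= 0 :> R by rewrite pmulrn -intrB lerz0; lia.
    by rewrite mulr_le0_ge0.
  have aK' : (`|a| <= k r)%N by lia.
  have [x' [ix' cx' hx']] := dsum_index_exists cr aK'.
  have dx' : depth x' = row_of M (stage v').
    have := depth_top x'; rewrite cx' ix' br tr => /addnI /eqP.
    by rewrite eqn_pmul2r // => /eqP ->.
  have -> : v' = kappa x'.
    apply: (cell_inj M_gt0 h_gt0); rewrite ?kappa_valid //.
    - by rewrite -cvv /= cx' ix' br.
    - by rewrite kappa_row.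
    - by rewrite kappa_level /pos hx' ix' -/K -/z; move: a0; rewrite /a; lia.
  rewrite omega_kappa /strong ladderE hx' ix' -/K.
  have -> : a = (`|a|%N)%:Z by lia.
  by rewrite -pmulrn.
apply: (@le_trans _ _ (strong x - N%:R^-1 * Num.sqrt ((K%:R - a%:~R) * (a%:~R + 1)))).
  by rewrite lerB.
have N0 : 0 < N%:R :> R by rewrite ltr0n.
rewrite /strong ladderE -mulrBr mulrC ler_pdivrMr // lerBlDl.
rewrite [del * _]mulrC; apply: sqrt_le_add; first by rewrite mulr_ge0 ?ler0n.
apply: le_trans (lerD (lexx _) variation).
set W := (4 * M * h)%:R; set p : R := (odd (k (irrep x)))%:R / 2.
have Kp : K%:R / 2 = (K./2)%:R + p :> R.
  by rewrite /p -(k_base br) -/K -[in LHS](odd_double_half K) natrD -mul2n natrM; field.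
have kp : (k (irrep x))%:R / 2 = ((k (irrep x))./2)%:R + p :> R.
  by rewrite /p -[in LHS](odd_double_half (k (irrep x))) natrD -mul2n natrM; field.
have ai : a%:~R = z%:~R + (K./2)%:R :> R by rewrite /a intrD -pmulrn.
have hi : (height x)%:R = (pos x)%:~R + ((k (irrep x))./2)%:R :> R.
  by rewrite /pos intrB -!pmulrn subrK.
have zi : `|(pos x)%:~R - z%:~R| <= W :> R.
  rewrite -intrB -intr_norm /W [leRHS]pmulrn ler_int. exact: lvv.
have hk : (height x)%:R <= (k (irrep x))%:R :> R by rewrite ler_nat height_le.
have h0 : 0 <= (height x)%:R :> R by rewrite ler0n.
have kN : (k (irrep x))%:R <= N%:R :> R by rewrite ler_nat.
have KN : K%:R <= N%:R :> R by rewrite ler_nat k_le.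
have K0 : 0 <= K%:R :> R by rewrite ler0n.
have kK1 : K%:R <= (k (irrep x))%:R + 2 * L%:R :> R.
  by rewrite -[2]/(2%:R) -natrM -natrD ler_nat.
have kK2 : (k (irrep x))%:R <= K%:R + 2 * L%:R :> R.
  by rewrite -[2]/(2%:R) -natrM -natrD ler_nat.
have L0 : 0 <= L%:R :> R by rewrite ler0n.
have W0 : 0 <= W by rewrite ler0n.
apply: ladder_variation => //.
rewrite hi kp ai Kp [X in `|X|](_ : _ = (pos x)%:~R - z%:~R) //; ring.
Qed.

Lemma omega_near v v' : valid M h v -> valid M h v' -> chain v = chain v' ->
  (row_of M (stage v) <= (row_of M (stage v')).+1)%N ->
  (row_of M (stage v') <= (row_of M (stage v)).+1)%N ->
  `|level h v - level h v'| <= (4 * M * h)%:Z -> `|omega v - omega v'| <= del.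
Proof.
move=> v1 v2 c r1 r2 l; rewrite ler_norml lerNl opprB !omega_drop // distrC //.
Qed.

Variables (C eps eta : R).
Hypothesis strong_le : forall x, strong x <= C.
Hypothesis C_ge0 : 0 <= C.
Hypothesis eps_dead : 2 * del <= eps.
Hypothesis eps_live : del + 2 * C / h%:R <= eps.
Hypothesis eta_le : N%:R^-1 * (2 * M%:R * h%:R + 1 / 2) <= eta.

Lemma chains_triple : exists A1 A2 A3 : 'M[R[i]]_d,
    [/\ comm_mx A1 A2, comm_mx A1 A3 & comm_mx A2 A3] /\
    [/\ A1 \is hermsymmx, A2 \is hermsymmx & A3 \is hermsymmx] /\
    [/\ opnorm (A1 - scaled_dsum N k n (spin1 R)) <= 2 * eps,
        opnorm (A2 - scaled_dsum N k n (spin2 R)) <= 2 * eps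
      & opnorm (A3 - scaled_dsum N k n (spin3 R)) <= eta] /\
    [/\ A1 \is a realmx, 'i%C *: A2 \is a realmx & A3 \is a realmx].
Proof.
have omega_le v : omega v <= C.
  by rewrite /omega; case: pickP => // x _; exact: strong_le.
have row_lt x : (row_of M (stage (kappa x)) < M.-1)%N by rewrite kappa_row.
have eta0 : 0 <= eta.
  apply: le_trans eta_le; apply: mulr_ge0; first by rewrite invr_ge0 ler0n.
  by apply: addr_ge0; rewrite ?divr_ge0 // !mulr_ge0.
have [P [B [[nP sB PB] [b1 b1' b3]]]] := conveyor_normal M_gt0 h_gt0 kappa_inj
  kappa_valid row_lt del_ge0 omega_ge0 omega_le omega_absent omega_near
  eps_dead eps_live eta0 (fun v pv => le_trans (center_near pv) eta_le).
rewrite -raisemx_pmx in b1 b1'; rewrite -weightsmx_pmx in b3.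
rewrite scaled_dsum_spin1 scaled_dsum_spin2 scaled_dsum_spin3.
apply: commuting_triple nP sB PB b1 b1' b3 => //.
by rewrite mulr_ge0 // (le_trans _ eps_dead) // mulr_ge0.
Qed.

End Chains.

(** * Numerical estimates for [X >= 12] *)

Section Numerics.
Variables (R : realFieldType) (X N L M h S : R).
Hypotheses (X12 : 12 <= X) (NX : N = X ^+ 7).
Hypotheses (LX : L <= 1045 / 1000 * X ^+ 4) (XL : 1045 / 1000 * X ^+ 4 < L + 1).
Hypotheses (M0 : 0 <= M) (MX : M <= X ^+ 3 / 2) (XM : X ^+ 3 / 2 < M + 1).
Hypotheses (h0 : 0 <= h) (hX : h <= X) (Xh : X < h + 1).
Hypotheses (S0 : 0 <= S) (SN : S ^+ 2 = N).
Local Notation del := (52 / 100 / X).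
Local Notation eps := (3143 / 1000 / X).

Lemma X_gt0 : 0 < X. Proof. by move: X12; lra. Qed.

(** Lets [lra] compare polynomials in [X] with the powers as independent unknowns. *)
Lemma X_step j : 12 * X ^+ j <= X ^+ j.+1.
Proof. by rewrite exprS; apply: ler_wpM2r; rewrite ?exprn_ge0 // ltW // X_gt0. Qed.

Lemma X_ge1 j : 1 <= X ^+ j.
Proof. by apply: exprn_ege1; move: X12; lra. Qed.

Lemma N_gt0r : 0 < N.
Proof. by rewrite NX exprn_gt0 // X_gt0. Qed.

Lemma N_del : N * del = 52 / 100 * X ^+ 6.
Proof. by rewrite NX; field; rewrite gt_eqF // X_gt0. Qed.

Lemma Mh_le : M * h <= X ^+ 4 / 2.
Proof.
have -> : X ^+ 4 / 2 = X ^+ 3 / 2 * X by field.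
by rewrite ler_pM.
Qed.

Lemma eps_dead_num : 2 * del <= eps.
Proof. by rewrite mulrA ler_pM2r ?invr_gt0 ?X_gt0 //; lra. Qed.

Lemma eps_live_num : del + 2 * (501 / 1000) / h <= eps.
Proof.
have hp : 0 < h by move: X12 Xh; lra.
have Xp := X_gt0.
rewrite -subr_ge0; have -> : eps - (del + 2 * (501 / 1000) / h) =
  (2623 / 1000 * h - 1002 / 1000 * X) / (X * h).
  by field; rewrite !gt_eqF.
by rewrite divr_ge0 ?mulr_ge0 //; move: X12 Xh; lra.
Qed.

Lemma eta_num : N^-1 * (2 * M * h + 1 / 2) <= 1083 / 1000 * (X ^+ 3)^-1.
Proof.
have Np := N_gt0r; rewrite mulrC ler_pdivrMr //.
have -> : 1083 / 1000 * (X ^+ 3)^-1 * N = 1083 / 1000 * X ^+ 4.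
  by rewrite NX; field; rewrite gt_eqF // X_gt0.
by have := Mh_le; have := X_step 3; have := X_ge1 3; rewrite -mulrA; lra.
Qed.

(** The leading term on the left is [3.045 X^11]; on the right [0.52^2 X^12 >= 3.24 X^11], which
    explains the constant in [del]. *)
Lemma variation_num :
  L * (N + 1) + 4 * M * h * (N + 4 * M * h + 1) <= (N * del) ^+ 2.
Proof.
set W := 4 * M * h.
have W0 : 0 <= W by rewrite /W !mulr_ge0.
have W2 : W <= 2 * X ^+ 4 by have := Mh_le; rewrite /W -mulrA; lra.
have Np := N_gt0r.
have l1 : L * (N + 1) <= 1045 / 1000 * X ^+ 4 * (N + 1) by apply: ler_wpM2r; move: LX; lra.
have l2 : W * (N + W + 1) <= 2 * X ^+ 4 * (N + 2 * X ^+ 4 + 1) by apply: ler_pM; lra.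
apply: le_trans (lerD l1 l2) _; rewrite N_del.
have -> : 1045 / 1000 * X ^+ 4 * (N + 1) + 2 * X ^+ 4 * (N + 2 * X ^+ 4 + 1) =
  3045 / 1000 * X ^+ 11 + 4 * X ^+ 8 + 3045 / 1000 * X ^+ 4 by rewrite NX; field.
have -> : (52 / 100 * X ^+ 6) ^+ 2 = 2704 / 10000 * X ^+ 12 by field.
have := X_step 11; have := X_step 10; have := X_step 9; have := X_step 8.
have := X_step 7; have := X_step 6; have := X_step 5; have := X_step 4; have := X_ge1 4.
lra.
Qed.

Lemma sqrt_num : S <= 3 / 10 * X ^+ 4.
Proof.
rewrite -(@ler_pXn2r _ 2) ?nnegrE //; last first.
  by apply: mulr_ge0; [lra | exact: exprn_ge0 (ltW X_gt0)].
rewrite SN NX; have -> : (3 / 10 * X ^+ 4) ^+ 2 = 9 / 100 * X ^+ 8 by field.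
by have := X_step 7; have := X_ge1 7; lra.
Qed.

Lemma small_num K : K <= 2 * (1 / 2 * S + 1) + 2 * L -> N^-1 * ((K + 1) / 2) <= del.
Proof.
move=> KS; rewrite mulrC ler_pdivrMr ?N_gt0r // [leRHS]mulrC N_del.
have := sqrt_num; have := X_step 5; have := X_step 4; have := X_ge1 4; move: LX; lra.
Qed.

Lemma strong_num K : K <= N -> N^-1 * ((K + 1) / 2) <= 501 / 1000.
Proof.
move=> KN; rewrite mulrC ler_pdivrMr ?N_gt0r //.
have := X_step 6; have := X_step 5; have := X_step 4; have := X_step 3; have := X_ge1 3.
by rewrite NX in KN *; lra.
Qed.

(** Since 1.045 exceeds 1, [u] is at most [X^3 / 2.088]; the gap to [X^3 / 2] leaves room for an
    empty bottom row. *)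
Lemma depth_num u : 0 <= u -> 2 * L * u <= N -> u + 2 <= M.
Proof.
move=> u0 uN.
have L1 : 1044 / 1000 * X ^+ 4 <= L.
  by have := X_step 3; have := X_step 2; have := X_step 1; have := X_ge1 1; move: XL; lra.
have : X ^+ 4 * (2088 / 1000 * u) <= X ^+ 4 * X ^+ 3.
  rewrite -exprD -NX; apply: le_trans uN.
  have -> : X ^+ 4 * (2088 / 1000 * u) = 2 * (1044 / 1000 * X ^+ 4) * u by field.
  by apply: ler_wpM2r => //; rewrite ler_pM2l.
rewrite ler_pM2l ?exprn_gt0 ?X_gt0 // => u1.
by have := X_step 2; have := X_step 1; have := X_ge1 1; move: XM; lra.
Qed.

End Numerics.

(** * The range [X <= 12] *)

Section SmallN.
Variables (R : realType) (N m : nat) (k n : 'I_m -> nat).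
Hypotheses (N_gt0 : (0 < N)%N) (k_le : forall r, (k r <= N)%N).
Local Notation d := (dimS k n).

Lemma raisemx_neq0 (x y : 'I_d) : raisemx R N k n x y != 0 ->
  [/\ irrep x = irrep y, copy x = copy y & height x = (height y).+1].
Proof.
rewrite mxE; case: ifP => [/andP[/eqP i /eqP c]|_]; last by rewrite mulr0 eqxx.
by rewrite /raising; case: ifP => [/eqP h|_]; last by rewrite mulr0 eqxx.
Qed.

Lemma weightsmx_sym : (weightsmx R N k n)^T = weightsmx R N k n.
Proof.
apply/matrixP => x y; rewrite !mxE sameC; case: ifP => // /andP[/eqP -> _].
by rewrite eq_sym; case: eqP => // ->.
Qed.

Lemma raisemx_bounded (B : R) : N%:R^-1 * ((N%:R + 1) / 2) <= B ->
  bounded_by B (0 - raisemx R N k n) /\ bounded_by B (0 - raisemx R N k n)^T.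
Proof.
move=> NB.
have col x y y' : y != y' -> raisemx R N k n x y * raisemx R N k n x y' = 0.
  move=> ne; apply/eqP; apply: contraNT ne; rewrite mulf_eq0 negb_or.
  move=> /andP[/raisemx_neq0[i c h] /raisemx_neq0[i' c' h']].
  by apply/eqP/dsum_index_inj; rewrite -?i -?c //; apply: succn_inj; rewrite -h -h'.
have row x x' y : x != x' -> raisemx R N k n x y * raisemx R N k n x' y = 0.
  move=> ne; apply/eqP; apply: contraNT ne; rewrite mulf_eq0 negb_or.
  move=> /andP[/raisemx_neq0[i c h] /raisemx_neq0[i' c' h']].
  by apply/eqP/dsum_index_inj; rewrite ?i ?c ?h.
have leB x y : `|raisemx R N k n x y| <= B.
  apply: le_trans NB; rewrite mxE normrM ger0_norm ?invr_ge0 ?ler0n //.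
  apply: ler_wpM2l; first by rewrite invr_ge0 ler0n.
  have N0 : 0 <= (N%:R + 1) / 2 :> R by rewrite divr_ge0 // addr_ge0 // ler0n.
  case: ifP => _; last by rewrite normr0.
  rewrite /raising; case: ifP => _; last by rewrite normr0.
  rewrite ger0_norm ?sqrtr_ge0 // (le_trans (ladder_le _ _ _)) //.
  by rewrite ler_pM2r ?invr_gt0 // lerD2r ler_nat.
have E x y : (0 - raisemx R N k n) x y = - raisemx R N k n x y.
  by rewrite mxE [X in X + _]mxE add0r mxE.
split; apply: bounded_sparse => *; rewrite ?[(_^T) _ _]mxE !E ?mulrNN ?normrN;
  by [apply: col | apply: row | apply: leB].
Qed.

Lemma small_N_triple (e1 e3 : R) : 0 <= e3 -> N%:R^-1 * ((N%:R + 1) / 2) <= e1 ->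
  exists A1 A2 A3 : 'M[R[i]]_d,
    [/\ comm_mx A1 A2, comm_mx A1 A3 & comm_mx A2 A3] /\
    [/\ A1 \is hermsymmx, A2 \is hermsymmx & A3 \is hermsymmx] /\
    [/\ opnorm (A1 - scaled_dsum N k n (spin1 R)) <= e1,
        opnorm (A2 - scaled_dsum N k n (spin2 R)) <= e1
      & opnorm (A3 - scaled_dsum N k n (spin3 R)) <= e3] /\
    [/\ A1 \is a realmx, 'i%C *: A2 \is a realmx & A3 \is a realmx].
Proof.
move=> e30 e1N; have [b1 b2] := raisemx_bounded e1N.
rewrite scaled_dsum_spin1 scaled_dsum_spin2 scaled_dsum_spin3.
apply: (@commuting_triple _ _ 0 (weightsmx R N k n)) => //.
- apply: le_trans e1N; rewrite mulr_ge0 ?invr_ge0 ?divr_ge0 ?addr_ge0 ?ler0n //.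
- by rewrite trmx0.
- exact: weightsmx_sym.
- by rewrite mulmx0 mul0mx.
- move=> v; rewrite subrr mul0mx /sqnorm big1 => [|i _]; last by rewrite mxE expr0n.
  by rewrite mulr_ge0 ?sqr_ge0 // sqnorm_ge0.
Qed.

End SmallN.

(** After multiplication by [X^7] the left side is at most [6 X^6 + 1/2] and the right side is
    [6.286 X^6]. The margin absorbs 1/2 only if [X^6] is not close to 1, hence the split at 6. *)
Lemma small_N_num (R : realFieldType) (X : R) : 1 <= X -> X <= 12 ->
  (X ^+ 7)^-1 * ((X ^+ 7 + 1) / 2) <= 6286 / 1000 / X.
Proof.
move=> X1 X12; have Xp : 0 < X by lra.
have X6 : 1 <= X ^+ 6 by apply: exprn_ege1.
rewrite mulrC ler_pdivrMr ?exprn_gt0 //.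
have -> : 6286 / 1000 / X * X ^+ 7 = 6286 / 1000 * X ^+ 6.
  by field; rewrite gt_eqF.
rewrite exprS; have [X6'|X6'] := leP X 6.
  have : X * X ^+ 6 <= 6 * X ^+ 6 by apply: ler_wpM2r; lra.
  lra.
have : X * X ^+ 6 <= 12 * X ^+ 6 by apply: ler_wpM2r; lra.
have X5 : 1 <= X ^+ 5 by apply: exprn_ege1.
have : 6 * X ^+ 5 <= X * X ^+ 5 by apply: ler_wpM2r; lra.
by rewrite -exprS; lra.
Qed.

Theorem theorem9p2p2 (R : realType) (N m : nat) (k : 'I_m -> nat)
    (istar : 'I_m) (n : 'I_m -> nat)
    (N_ge1 : (1 <= N)%N)
    (step : (forall r s : 'I_m, s = r.+1 :> nat ->
               spin R (k s) - spin R (k r) = 1)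
         \/ (forall r s : 'I_m, s = r.+1 :> nat ->
               spin R (k s) - spin R (k r) = 1 / 2))
    (last_le : forall r : 'I_m, r.+1 = m :> nat ->
       spin R (k r) <= 1 / 2 * N%:R)
    (istar_le : spin R (k istar) <= 1 / 2 * Num.sqrt N%:R + 1)
    (mult_le : forall i j : 'I_m, (istar <= i)%N ->
       j = (i + Lgap R N)%N :> nat -> (n j <= n i)%N) :
  exists A1 A2 A3 : 'M[R[i]]_(dimS k n),
    [/\ comm_mx A1 A2, comm_mx A1 A3 & comm_mx A2 A3] /\
    [/\ A1 \is hermsymmx, A2 \is hermsymmx & A3 \is hermsymmx] /\
    [/\ opnorm (A1 - scaled_dsum N k n (spin1 R))
          <= 6286 / 1000 * N%:R `^ (- (1 / 7)),
        opnorm (A2 - scaled_dsum N k n (spin2 R))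
          <= 6286 / 1000 * N%:R `^ (- (1 / 7))
      & opnorm (A3 - scaled_dsum N k n (spin3 R))
          <= 1083 / 1000 * N%:R `^ (- (3 / 7))] /\
    [/\ A1 \is a realmx, 'i%C *: A2 \is a realmx & A3 \is a realmx].
Proof.
set X : R := N%:R `^ (1 / 7).
have N0 : 0 <= N%:R :> R by rewrite ler0n.
have Xpow j : N%:R `^ (j%:R / 7) = X ^+ j.
  rewrite /X -powR_mulrn ?powR_ge0 // -powRrM; congr (_ `^ _); ring.
have NX : N%:R = X ^+ 7 by rewrite -(Xpow 7%N) divff ?powRr1 // pnatr_eq0.
have X1 : 1 <= X.
  rewrite leNgt; apply/negP => X1; have : X ^+ 7 < 1 by rewrite exprn_ilt1 ?powR_ge0.
  by rewrite -NX ltrn1; case: (N) N_ge1.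
rewrite !powRN (Xpow 3%N) -/X.
(* [st] is the increment of the doubled spin [k]: 2 for spin step 1, and 1 for spin step 1/2. *)
have [st [st0 k_step]] : exists st : nat, ((st == 1) || (st == 2))%N /\
    (forall r s : 'I_m, s = r.+1 :> nat -> (k s = k r + st)%N).
  case: step => [H|H]; [exists 2%N | exists 1%N]; split=> // r s /H; rewrite /spin => e;
    apply/eqP; rewrite -(eqr_nat R) natrD; apply/eqP; lra.
have k_up t (r s : 'I_m) : s = (r + t)%N :> nat -> (k s = k r + st * t)%N.
  elim: t s => [|t IH] s e.
    by rewrite muln0 addn0; congr k; apply: val_inj; rewrite /= e addn0.
  have lt : (r + t < m)%N by have := ltn_ord s; rewrite e; lia.
  rewrite (k_step (Ordinal lt) s); last by rewrite e /= addnS.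
  by rewrite (IH (Ordinal lt)) // mulnS; lia.
have k_affine (r s : 'I_m) : (k r + st * s = k s + st * r)%N.
  wlog rs : r s / (r <= s)%N => [H|].
    by have [/H|/ltnW /H] := leqP r s.
  have e : s = (r + (s - r))%N :> nat by lia.
  by rewrite (k_up _ _ _ e) mulnBr; have := leq_mul (leqnn st) rs; lia.
have k_le r : (k r <= N)%N.
  have mp : (m.-1 < m)%N by have := ltn_ord istar; lia.
  have := last_le (Ordinal mp) (prednK (leq_ltn_trans (leq0n _) mp)).
  rewrite /spin => le1; have le2 : (k (Ordinal mp) <= N)%N.
    by rewrite -(ler_nat R); lra.
  have := k_affine r (Ordinal mp); rewrite /= => e.
  have : (st * r <= st * m.-1)%N by rewrite leq_mul2l; have := ltn_ord r; lia.
  lia.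
have k_near (r : 'I_m) g l : (st * g = 2 * l)%N -> (r < istar + g)%N ->
    (k r)%:R <= 2 * (1 / 2 * Num.sqrt N%:R + 1) + 2 * l%:R :> R.
  move=> gl rg; have : (k r <= k istar + 2 * l)%N.
    have := k_affine r istar; have := leq_mul (leqnn st) (ltnW rg).
    by rewrite mulnDr gl; lia.
  by rewrite -(ler_nat R) natrD natrM; move: istar_le; rewrite /spin; lra.
have lt_pred (u p : nat) : (u + 2 <= p -> u < p.-1)%N by lia.
have X0 : 0 < X by lra.
have [X12|X12] := leP X 12.
  apply: small_N_triple => //.
    by rewrite mulr_ge0 ?invr_ge0 ?exprn_ge0 ?divr_ge0 ?ltW.
  by rewrite NX small_N_num.
have posX j : 0 <= X ^+ j by rewrite exprn_ge0 // ltW.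
have floorP (y : R) : 0 <= y -> exists t : nat, t%:R <= y /\ y < t%:R + 1.
  by move=> y0; exists (Num.truncn y); rewrite truncn_le natr1 truncnS_gt.
have LX : (Lgap R N)%:R <= 1045 / 1000 * X ^+ 4 :> R.
  by rewrite /Lgap (Xpow 4%N) truncn_le; apply: mulr_ge0; [lra | exact: posX].
have XL : 1045 / 1000 * X ^+ 4 < (Lgap R N)%:R + 1 :> R.
  by rewrite /Lgap (Xpow 4%N) natr1 truncnS_gt.
move: (Lgap R N) LX XL mult_le => L LX XL mult_le.
(* [M] is the floor of [X^3 / 2] and [h] that of [X], so half a piece, [2Mh], is at most [X^4];
   divided by [N] this is the order [X^-3] of the third error. *)
have [M [MX XM]] : exists t : nat, t%:R <= X ^+ 3 / 2 /\ X ^+ 3 / 2 < t%:R + 1.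
  by apply: floorP; apply: mulr_ge0; [exact: posX | lra].
have [h [hX Xh]] := floorP X (ltW X0).
clear Xpow; clearbody X.
have X12' : 12 <= X by exact: ltW.
have SN : Num.sqrt N%:R ^+ 2 = N%:R :> R by rewrite sqr_sqrtr.
have S0 : 0 <= Num.sqrt N%:R :> R by exact: sqrtr_ge0.
have M0 : 0 <= M%:R :> R by rewrite ler0n.
have h0 : 0 <= h%:R :> R by rewrite ler0n.
(* [G] indices correspond to a spin difference [L]. For spin step 1/2 this takes [2 * L] indices,
   and the hypothesis on multiplicities is applied twice. *)
have [G eG] : exists G, G = if st == 1%N then (2 * L)%N else L by eexists.
have stG : (st * G = 2 * L)%N.
  by rewrite eG; case/orP: st0 => /eqP ->; rewrite /= ?mul1n.
have L_gt0 : (0 < L)%N.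
  rewrite -(ltr0n R); have := X_step X12' 3; have := X_ge1 X12' 3; lra.
have M_gt0 : (0 < M)%N.
  rewrite -(ltr0n R); have := X_step X12' 2; have := X_ge1 X12' 2; lra.
have h_gt0 : (0 < h)%N by rewrite -(ltr0n R); lra.
have G_gt0 : (0 < G)%N by rewrite eG; case: ifP => _; rewrite ?muln_gt0.
have n_mono (i j : 'I_m) : (istar <= i)%N -> j = (i + G)%N :> nat -> (n j <= n i)%N.
  rewrite eG; case: ifP => _ ii e; last exact: mult_le.
  have lt : (i + L < m)%N.
    by apply: leq_ltn_trans (ltn_ord j); rewrite e leq_add2l leq_pmull.
  apply: (@leq_trans (n (Ordinal lt))); last exact: mult_le.
  by apply: mult_le; rewrite /= ?e ?mul2n -?addnn ?addnA // (leq_trans ii) ?leq_addr.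
pose del : R := 52 / 100 / X.
have strong_bound (x : 'I_(dimS k n)) :
    strong R N x <= N%:R^-1 * (((k (irrep x))%:R + 1) / 2).
  by apply: ler_wpM2l; rewrite ?invr_ge0 ?ler0n // ladder_le.
have e1 : 2 * (3143 / 1000 / X) = 6286 / 1000 / X by rewrite mulrA; congr (_ / X); field.
rewrite -e1.
apply: (@chains_triple R N m k n istar st G L G_gt0 stG k_affine k_le n_mono M h
  M_gt0 h_gt0 N_ge1 _ del _ _ _ (501 / 1000)) => //.
- move=> x; have := depth_num X12' NX XL XM (ler0n R (depth istar G x)).
  rewrite -[2]/(2%:R) -!natrM -natrD !ler_nat => dl.
  exact: lt_pred (dl (depth_le istar G_gt0 stG k_affine k_le x)).
- by rewrite divr_ge0 ?divr_ge0 // ltW.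
- move=> x xi; apply: le_trans (strong_bound x) _; apply: (small_num X12' NX LX S0 SN).
  exact: k_near stG xi.
- rewrite !natrM; exact: variation_num X12' NX LX M0 MX h0 hX.
- move=> x; apply: le_trans (strong_bound x) _; apply: (strong_num X12' NX).
  by rewrite ler_nat.
- by rewrite divr_ge0.
- exact: eps_dead_num X12'.
- exact: eps_live_num X12' h0 Xh.
- exact: eta_num X12' NX M0 MX h0 hX.
Qed.
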